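(* If $H_1,H_2,H_3$ are heroes, then $\Delta(H_1,H_2,H_3)$ is a rebel.
   Context: All tournaments are finite. The chromatic number $\chi(T)$ of a tournament $T$ is the minimum $k$ such that $V(T)$ is the union of $k$ sets each inducing an acyclic (transitive) subtournament. The domination number $\operatorname{dom}(T)$ is the size of the smallest set $X\subseteq V(T)$ such that every vertex in $V(T)\setminus X$ is adjacent from a vertex in $X$ (i.e. is the head of an edge with tail in $X$). A tournament is $H$-free if none of its subtournaments is isomorphic to $H$. A tournament $H$ is a hero if for some $c>0$ every $H$-free tournament has chromatic number less than $c$. A tournament $H$ is a rebel if for some $c>0$ every $H$-free tournament has domination number less than $c$. For tournaments $H_1,H_2,H_3$, $\Delta(H_1,H_2,H_3)$ denotes the tournament $T$ with vertex set the disjoint union of three sets $A_1,A_2,A_3$, where $T[A_i]$ is isomorphic to $H_i$ for $i=1,2,3$, all edges between $A_1$ and $A_2$ are directed from $A_1$ to $A_2$, all edges between $A_2$ and $A_3$ are directed from $A_2$ to $A_3$, and all edges between $A_3$ and $A_1$ are directed from $A_3$ to $A_1$. *)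

(* Defs.v *)
From mathcomp Require Import all_boot.

Set Implicit Arguments.
Unset Strict Implicit.
Unset Printing Implicit Defensive.

(* The null tournament (no vertex) is allowed. *)
Record tournament := Tournament {
  vertex :> finType;
  arc : rel vertex;
  arc_irr : irreflexive arc;
  arc_xor : forall x y, x != y -> arc x y (+) arc y x }.

Section Induced.
Variables (T : tournament) (X : {set T}).

Definition induced_arc : rel {x : T | x \in X} :=
  fun x y => arc (val x) (val y).

Lemma induced_arc_irr : irreflexive induced_arc.
Proof. by move=> x; apply: arc_irr. Qed.

Lemma induced_arc_xor x y : x != y -> induced_arc x y (+) induced_arc y x.
Proof. by move=> xy; apply: arc_xor; rewrite (inj_eq val_inj). Qed.

Definition induced : tournament := Tournament induced_arc_irr induced_arc_xor.
End Induced.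

Definition isomorphic (S T : tournament) : Prop :=
  exists2 f : S -> T, bijective f & forall x y, arc (f x) (f y) = arc x y.

Definition free (H T : tournament) : Prop :=
  forall X : {set T}, ~ isomorphic (induced X) H.

(* A directed cycle is a nonempty sequence of distinct vertices, so its length
   is between 1 and #|T|. *)
Definition acyclic (T : tournament) : bool :=
  [forall n : 'I_#|T|, forall s : n.+1.-tuple T, ~~ ucycleb (@arc T) s].

Lemma acyclicP (T : tournament) :
  reflect (forall s : seq T, s != [::] -> ~ ucycle (@arc T) s) (acyclic T).
Proof.
apply: (iffP idP) => [/forallP acT s s0 cs | noc].
- have us : uniq s by case/andP: cs.
  have /prednK sz : 0 < size s by rewrite lt0n size_eq0.
  have lt_s : (size s).-1 < #|T| by rewrite sz -(card_uniqP us) max_card.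
  have szs : size s == (Ordinal lt_s).+1 by rewrite /= sz.
  by move/forallP/(_ (Tuple szs))/negP: (acT (Ordinal lt_s)); apply.
- apply/forallP => n; apply/forallP => s; apply/negP; apply: noc.
  by rewrite -size_eq0 size_tuple.
Qed.

Definition colorable (T : tournament) (k : nat) : bool :=
  [exists F : {ffun 'I_k -> {set T}},
     [forall i, acyclic (induced (F i))] && (\bigcup_i F i == [set: T])].

Lemma ex_colorable (T : tournament) : exists k, colorable T k.
Proof.
exists #|T|; apply/existsP; exists [ffun i => [set enum_val i]].
apply/andP; split.
- apply/forallP => i; rewrite ffunE; apply/acyclicP => -[|x s] // _ /andP[+ _].
  have eqx (y : induced [set enum_val i]) : y = x.
    apply: val_inj; case: x y => [x /= /set1P ->] [y /=].
    by move/set1P.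
  have noarc (y : induced [set enum_val i]) : ~~ arc x y.
    by rewrite (eqx y) arc_irr.
  by case: s => [|y s] /andP[+ _]; apply/negP; apply: noarc.
- apply/eqP/setP => x; rewrite inE; apply/bigcupP; exists (enum_rank x) => //.
  by rewrite ffunE enum_rankK set11.
Qed.

Definition chi (T : tournament) : nat := ex_minn (ex_colorable T).

Definition dominating (T : tournament) (X : {set T}) : bool :=
  [forall y in ~: X, exists x in X, arc x y].

Lemma dominating_setT (T : tournament) : dominating [set: T].
Proof. by apply/forall_inP => y; rewrite setCT inE. Qed.

(* The default [set: T] of arg min is dominating (see dominating_setT). *)
Definition dom (T : tournament) : nat :=
  #|[arg min_(X < [set: T] | dominating X) #|X| ]|.

Definition hero (H : tournament) : Prop :=
  exists2 c : nat, 0 < c & forall T : tournament, free H T -> chi T < c.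

Definition rebel (H : tournament) : Prop :=
  exists2 c : nat, 0 < c & forall T : tournament, free H T -> dom T < c.

Section Delta.
Variables H1 H2 H3 : tournament.

Definition Delta_arc : rel (H1 + H2 + H3)%type := fun x y =>
  match x, y with
  | inl (inl a), inl (inl b) => arc a b
  | inl (inr a), inl (inr b) => arc a b
  | inr a, inr b => arc a b
  | inl (inl _), inl (inr _) => true
  | inl (inr _), inr _ => true
  | inr _, inl (inl _) => true
  | _, _ => false
  end.

Lemma Delta_arc_irr : irreflexive Delta_arc.
Proof. by case=> [[]|] x; apply: arc_irr. Qed.

Lemma Delta_arc_xor x y : x != y -> Delta_arc x y (+) Delta_arc y x.
Proof. by case: x y => [[x|x]|x] [[y|y]|y] // xy; apply: arc_xor. Qed.

Definition Delta : tournament := Tournament Delta_arc_irr Delta_arc_xor.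
End Delta.

(* Main.v *)
Require Import Defs.
From mathcomp Require Import all_boot.
From mathcomp Require Import all_order all_algebra.
From mathcomp Require Import zify lra ring.
(* [path.arc] would otherwise shadow [Defs.arc]. *)
Import Defs.

(** A hero appears in the tournaments whose back arcs form a shift graph, since these have
    unbounded chromatic number; as they are locally 2-colourable, so is every hero.  It is then
    enough to find [Delta H H H], for one 2-colourable [H], in every tournament of large
    domination number.

    Call a vertex set large if no few vertices dominate it.  If every vertex of a large set
    carries a positive proportion of a probability space of colours, some copy of [H] in that set
    is monochromatic for a positive proportion of the colours: by minimax, some distribution on
    the set dominates each vertex within its own colours; samples of it are not dominating, and
    exchanging two samples produces a large monochromatic shattered set (Sauer-Shelah), which
    contains all 2-colourable tournaments of bounded size.

    Linear programming together with this fact yields a distribution [p] that dominates a large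
    set with constant probability and gives small mass to every set without a copy of [H].
    Either the monochromatic copies, with out-neighbourhoods or in-neighbourhoods in [p] as
    colours, close up to [Delta H H H], or a large set [B] sends almost no arcs to a restriction of
    [p].  In that case a second such distribution, chosen inside [B], gives the three
    copies. *)

Set Implicit Arguments.
Unset Strict Implicit.
Unset Printing Implicit Defensive.

(** * Shattered sets *)

Definition shatters (K : finType) (F : {set {set K}}) (D : {set K}) : bool :=
  [forall (E : {set K} | E \subset D), exists S in F, S :&: D == E].

Lemma shattersP (K : finType) (F : {set {set K}}) (D : {set K}) :
  reflect (forall E : {set K}, E \subset D -> exists2 S, S \in F & S :&: D = E) (shatters F D).
Proof.
apply: (iffP forall_inP) => sh E sED.
  by have /exists_inP[S SF /eqP] := sh E sED; exists S.
by have [S SF eqE] := sh E sED; apply/exists_inP; exists S => //; apply/eqP.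
Qed.

(* Pajor: splitting at a point x, a set shattered by both halves can be enlarged by x. *)
Lemma card_le_shattered (K : finType) (F : {set {set K}}) :
  #|F| <= #|[set D | shatters F D]|.
Proof.
have [n] := ubnP #|F|; elim: n F => // n IH F /ltnSE leFn.
case: (set_0Vmem F) => [-> | [S0 S0F]]; first by rewrite cards0.
have [/cards1P[S ->]|ntF] := boolP (#|F| == 1).
  rewrite cards1; apply/card_gt0P; exists set0; rewrite inE; apply/shattersP => E.
  by rewrite subset0 => /eqP ->; exists S; rewrite ?set11 ?setI0.
have [S1 S1F neS] : exists2 S, S \in F & S != S0.
  have : 0 < #|F :\ S0| by have := cardsD1 S0 F; rewrite S0F; move: ntF => /eqP; lia.
  by case/card_gt0P=> S /setD1P[neS SF]; exists S.
have [x xS] : exists x, (x \in S1) != (x \in S0).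
  apply/existsP; apply: contraR neS => /existsPn eqS; apply/eqP/setP => x.
  by have := eqS x; rewrite negbK => /eqP.
pose Fx := [set S in F | x \in S]; pose Fn := [set S in F | x \notin S].
have cardF : #|F| = #|Fx| + #|Fn|.
  rewrite -(cardsID [set S : {set K} | x \in S] F); congr (_ + _); apply: eq_card => S.
    by rewrite !inE.
  by rewrite !inE andbC.
have [Sx SxF] : exists S, S \in Fx.
  have [xS1|xS1] := boolP (x \in S1); first by exists S1; rewrite inE S1F.
  by exists S0; rewrite inE S0F; move: xS; rewrite (negPf xS1); case: (x \in S0).
have [Sn SnF] : exists S, S \in Fn.
  have [xS1|xS1] := boolP (x \in S1); last by exists S1; rewrite inE S1F.
  by exists S0; rewrite inE S0F; move: xS; rewrite xS1; case: (x \in S0).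
have px : 0 < #|Fx| by apply/card_gt0P; exists Sx.
have pn : 0 < #|Fn| by apply/card_gt0P; exists Sn.
have IHx := IH Fx; have IHn := IH Fn.
set shx := [set D | shatters Fx D] in IHx; set shn := [set D | shatters Fn D] in IHn.
have nx D : D \in shx -> x \notin D.
  rewrite inE => /shattersP/(_ _ (sub0set D))[S]; rewrite inE => /andP[_ xS'] /setP/(_ x).
  by rewrite !inE xS' /= => ->.
have nn D : D \in shn -> x \notin D.
  rewrite inE => /shattersP/(_ _ (subxx D))[S]; rewrite inE => /andP[_ xS'] /setP/(_ x).
  by rewrite !inE (negPf xS') /= => <-.
pose ad (D : {set K}) := x |: D.
have inj_ad : {in shx :&: shn &, injective ad}.
  move=> D E /setIP[/nx xD _] /setIP[/nx xE _] /setP eqDE; apply/setP => y.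
  have := eqDE y; rewrite !inE; case: eqP => [->|//].
  by rewrite (negPf xD) (negPf xE).
have sub : (shx :|: shn) :|: ad @: (shx :&: shn) \subset [set D | shatters F D].
  apply/subsetP => D; move=> /setUP[/setUP[]|/imsetP[D' /setIP[Dx Dn] ->]].
  - rewrite !inE => /shattersP sh; apply/shattersP => E /sh[S].
    by rewrite inE => /andP[SF _] eqE; exists S.
  - rewrite !inE => /shattersP sh; apply/shattersP => E /sh[S].
    by rewrite inE => /andP[SF _] eqE; exists S.
  have xD := nx _ Dx; move: Dx Dn; rewrite !inE => /shattersP shX /shattersP shN.
  apply/shattersP => E sED.
  have sED' : E :\ x \subset D' by rewrite subDset.
  have [xE|xE] := boolP (x \in E).
    have [S] := shX _ sED'; rewrite inE => /andP[SF xS'] /setP eqE; exists S => //.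
    apply/setP => y; have := eqE y; rewrite !inE.
    by case: eqP => [->|//]; rewrite xS' xE.
  have [S] := shN _ sED'; rewrite inE => /andP[SF xS'] /setP eqE; exists S => //.
  apply/setP => y; have := eqE y; rewrite !inE.
  by case: eqP => [->|//]; rewrite (negPf xS') (negPf xE).
apply: leq_trans (subset_leq_card sub).
have dis : (shx :|: shn) :&: ad @: (shx :&: shn) = set0.
  apply/setP => D; rewrite !inE; apply/negP => /andP[Dxn /imsetP[D' _ eqD]].
  have xD : x \in D by rewrite eqD !inE eqxx.
  by case/orP: Dxn => shD; [have := nx D | have := nn D]; rewrite inE shD xD => /(_ isT).
rewrite cardsU dis cards0 subn0 (card_in_imset inj_ad).
have := cardsUI shx shn.
have : #|Fx| < n by lia.
have : #|Fn| < n by lia.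
move=> /IHn h1 /IHx h2 h3; lia.
Qed.

(** A set of at most [d] elements is the set of [Some] values of a map from ['I_d] to [option K]. *)
Lemma card_small_sets (K : finType) d : #|[set D : {set K} | #|D| <= d]| <= #|K|.+1 ^ d.
Proof.
have cf : #|[set: {ffun 'I_d -> option K}]| = #|K|.+1 ^ d.
  by rewrite cardsT card_ffun card_option card_ord.
rewrite -cf.
pose im (f : {ffun 'I_d -> option K}) := [set k | [exists i, f i == Some k]].
apply: leq_trans (leq_imset_card im _); apply: subset_leq_card.
apply/subsetP => D; rewrite inE => leD.
apply/imsetP; exists [ffun i : 'I_d => nth None (map Some (enum D)) i]; first by rewrite inE.
apply/setP => k; rewrite inE; apply/idP/existsP => [kD|[i]].
  have ltk : index k (enum D) < size (enum D) by rewrite index_mem mem_enum.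
  have ltd : index k (enum D) < d by apply: leq_trans ltk _; rewrite -cardE.
  exists (Ordinal ltd); rewrite ffunE /= (nth_map k) // nth_index // mem_enum //.
rewrite ffunE => /eqP eqk.
have lti : i < size (enum D).
  by rewrite ltnNge; apply/negP => le; rewrite nth_default ?size_map in eqk.
rewrite (nth_map k) // in eqk; case: eqk => <-; rewrite -mem_enum mem_nth //.
Qed.

(** [F] shatters at least as many sets as it has members, so they cannot all have at most [d]
    elements. *)
Lemma sauer_shelah (K : finType) (F : {set {set K}}) d :
  #|K|.+1 ^ d < #|F| -> exists2 D, shatters F D & d < #|D|.
Proof.
move=> ltF; apply/exists_inP; apply: contraTT ltF => /exists_inPn no; rewrite -leqNgt.
apply: leq_trans (card_le_shattered F) _; apply: leq_trans (card_small_sets K d).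
by apply: subset_leq_card; apply/subsetP => D; rewrite !inE leqNgt; apply: no.
Qed.

Lemma exp_beats_poly d a : exists t, a * (a * t).+1 ^ d < 2 ^ t.
Proof.
(* For [t = 2 ^ x] the left side is at most 2 to a power linear in [x]; taking [x] as twice [y]
   gives [2 ^ x] at least [(y + 1) ^ 2], which exceeds that power. *)
pose y := (3 * d + a + 1) * (d.+1).
pose x := y + y.
exists (2 ^ x).
have la : a <= 2 ^ a by apply: ltnW; apply: ltn_expl.
have b1 : (a * 2 ^ x).+1 <= 2 ^ (a + x).+1.
  have := expn_gt0 2 (a + x); rewrite expnS expnD => h.
  have : a * 2 ^ x <= 2 ^ a * 2 ^ x by rewrite leq_mul2r la orbT.
  lia.
have b2 : a * (a * 2 ^ x).+1 ^ d <= 2 ^ (a + (a + x).+1 * d).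
  rewrite expnD expnM leq_mul //.
  by case: (posnP d) => [->|d0]; rewrite ?expn0 // leq_exp2r.
apply: leq_ltn_trans b2 _; rewrite ltn_exp2l //.
have yl : y < 2 ^ y by apply: ltn_expl.
have : y.+1 * y.+1 <= 2 ^ x by rewrite /x expnD leq_mul.
rewrite /x /y; nia.
Qed.

(** * Embeddings into tournaments *)

(** With equality included, [darc x y] is exactly the negation of [arc y x]: not being dominated by
    a vertex means beating it. *)
Definition darc (T : tournament) : rel T := fun x y => (x == y) || arc x y.

Section Tournament.
Variable T : tournament.
Implicit Types x y : T.

Lemma arc_asym x y : arc x y -> arc y x = false.
Proof.
have [->|/arc_xor] := eqVneq x y; first by rewrite arc_irr.
by case: (arc x y); case: (arc y x).
Qed.

Lemma darcN x y : ~~ darc x y = arc y x.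
Proof.
rewrite /darc; have [->|/arc_xor] := eqVneq x y; first by rewrite arc_irr.
by case: (arc x y); case: (arc y x).
Qed.

Lemma darc_arc x y : x != y -> darc x y = arc x y.
Proof. by rewrite /darc => /negPf ->. Qed.

Lemma darc_total x y : darc x y || darc y x.
Proof. by rewrite -[darc x y]negbK darcN /darc orbCA orNb orbT. Qed.

Lemma arc_neq x y : arc x y -> x != y.
Proof. by apply: contraTneq => ->; rewrite arc_irr. Qed.

End Tournament.

(** Preserving arcs suffices: between tournaments such a map also reflects arcs and is injective, so
    its image is an induced copy. *)
Definition embeds (H T : tournament) (A : {set T}) : bool :=
  [exists g : {ffun H -> T},
    [forall x, g x \in A] && [forall x, forall y, arc x y ==> arc (g x) (g y)]].

Lemma embedsP (H T : tournament) (A : {set T}) :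
  reflect (exists2 g : H -> T, forall x, g x \in A & forall x y, arc x y -> arc (g x) (g y))
          (embeds H A).
Proof.
apply: (iffP existsP) => [[g /andP[/forallP gA /forallP ga]]|[g gA ga]].
  by exists g => // x y; apply/implyP; move/forallP: (ga x).
exists (finfun g); apply/andP; split; apply/forallP => x; rewrite ?ffunE //.
by apply/forallP => y; apply/implyP; rewrite !ffunE; apply: ga.
Qed.

Lemma embedsS (H T : tournament) (A B : {set T}) : A \subset B -> embeds H A -> embeds H B.
Proof. by move=> /subsetP sAB /embedsP[g gA ga]; apply/embedsP; exists g => // x; apply/sAB. Qed.

Lemma arc_hom_eq (H T : tournament) (g : H -> T) :
  (forall x y, arc x y -> arc (g x) (g y)) -> forall x y, arc (g x) (g y) = arc x y.
Proof.
move=> ga x y; apply/idP/idP => [gxy|/ga //].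
rewrite -darcN; apply: contraL gxy => /orP[/eqP ->|/ga /arc_asym -> //].
by rewrite arc_irr.
Qed.

Lemma hom_not_free (H T : tournament) (g : H -> T) :
  (forall x y, arc x y -> arc (g x) (g y)) -> ~ free H T.
Proof.
move=> ga /(_ (g @: [set: H])); apply.
have inj_g : injective g.
  move=> x y eqg; apply/eqP; apply: contraT => /arc_xor.
  by rewrite -!(arc_hom_eq ga) eqg arc_irr.
pose k (x : H) : induced (g @: [set: H]) := Sub (g x) (imset_f g (in_setT x)).
have bk : bijective k.
  apply: inj_card_bij; first by move=> x y /(congr1 val) /inj_g.
  by rewrite card_sig (eq_card (B := g @: [set: H])) ?card_imset ?cardsT.
have [k' kk' k'k] := bk.
exists k'; first exact: Bijective k'k kk'.
by move=> x y; rewrite -{2}[x]k'k -{2}[y]k'k; apply/esym/(arc_hom_eq ga).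
Qed.

Lemma not_free_hom (H T : tournament) :
  (~ (exists g : H -> T, forall x y, arc x y -> arc (g x) (g y))) -> free H T.
Proof.
move=> no X [f [f' ff' f'f] fa]; apply: no; exists (fun x => val (f' x)) => x y.
by rewrite -{1}[x]f'f -{1}[y]f'f fa.
Qed.

(** One of the out- and in-neighbourhoods of a vertex [x] keeps at least [2 ^ n] of the [2 ^ n.+1]
    indices, and [x] is put before or after the sequence found there. The indexing [g] admits
    families of vertices as well as sets. *)
Lemma ramsey_transitive (I : finType) (T : tournament) (g : I -> T) n (D : {set I}) :
  injective g -> 2 ^ n <= #|D| ->
  exists s : seq I, [/\ size s = n, {subset s <= D} & pairwise (fun i j => arc (g i) (g j)) s].
Proof.
move=> inj_g; elim: n D => [|n IH] D leD; first by exists [::].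
have [x xD] : exists x, x \in D.
  by apply/set0Pn; rewrite -card_gt0; apply: leq_trans leD; rewrite expn_gt0.
pose Dp := [set y in D | arc (g x) (g y)]; pose Dm := [set y in D | arc (g y) (g x)].
have cD : #|D| = #|Dp| + #|Dm| + 1.
  rewrite (cardsD1 x) xD -(cardsID [set y | arc (g x) (g y)]) addnC; congr (_ + _ + _).
    apply: eq_card => y; rewrite !inE; case: eqP => [->|] /=; first by rewrite arc_irr andbF.
    by [].
  apply: eq_card => y; rewrite !inE; have [->|ne] := eqVneq y x; first by rewrite !arc_irr !andbF.
  rewrite andbC; congr (_ && _); rewrite -[arc (g y) _]darcN darc_arc //.
  by rewrite (inj_eq inj_g) eq_sym.
have [leDp|] := leqP (2 ^ n) #|Dp|.
  have [s [ss sD ps]] := IH _ leDp.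
  exists (x :: s); split; first by rewrite /= ss.
    by move=> y; rewrite inE => /predU1P[-> //|/sD]; rewrite inE => /andP[].
  rewrite pairwise_cons ps andbT; apply/allP => y /sD; by rewrite inE => /andP[].
move=> ltDp; have leDm : 2 ^ n <= #|Dm| by rewrite expnS in leD; lia.
have [s [ss sD ps]] := IH _ leDm.
exists (rcons s x); split; first by rewrite size_rcons ss.
  by move=> y; rewrite mem_rcons inE => /predU1P[-> //|/sD]; rewrite inE => /andP[].
rewrite pairwise_rcons ps andbT; apply/allP => y /sD; by rewrite inE => /andP[].
Qed.

(** Chromatic number at most 2, acyclicity of a colour class being expressed as transitivity. *)
Definition two_colorable (H : tournament) : Prop :=
  exists f : H -> bool,
    forall x y z, f x = f y -> f y = f z -> arc x y -> arc y z -> arc x z.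

(** The rank of a vertex is its number of in-neighbours of the same colour; it grows along arcs
    because the class is transitive. *)
Lemma rank_in_color (H : tournament) : two_colorable H ->
  exists (f : H -> bool) (r : H -> 'I_#|H|),
    forall x y, f x = f y -> arc x y -> r x < r y.
Proof.
case=> f ftr.
pose P x := [set y | (f y == f x) && arc y x].
have ltP x : #|P x| < #|H|.
  rewrite -cardsT; apply: proper_card; rewrite properE subsetT; apply/subsetPn; exists x => //.
  by rewrite inE arc_irr andbF.
exists f, (fun x => Ordinal (ltP x)) => x y eqf xy /=.
apply: proper_card; apply/properP; split.
  apply/subsetP => z; rewrite !inE eqf => /andP[/eqP fz zx].
  by rewrite fz eqxx (ftr _ _ _ _ _ zx xy) // fz eqf.
by exists x; rewrite !inE ?arc_irr ?andbF // eqf eqxx.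
Qed.

(* A shattered set is transitive after passing to a subset, and so is a set of shattering
   vertices; the former is cut into blocks, one for each vertex of the first class, each block
   containing every trace on the shattering vertices N + 1 times, so that a representative
   outside the N shattering vertices is available. *)
Lemma shattered_embeds (H : tournament) : two_colorable H ->
  exists d, forall (T : tournament) (D R : {set T}), d <= #|D| ->
    (forall E : {set T}, E \subset D ->
       exists2 v, v \in R & forall x, x \in D -> darc x v = (x \in E)) ->
    embeds H (D :|: R).
Proof.
case/rank_in_color=> f [r rlt].
pose q := #|H|; pose N := 2 ^ q.
pose W := ('I_N.+1 * {set 'I_N})%type.
exists (2 ^ (q * #|{: W}|)) => T D R leD sh.
have [s [ss sD ps]] := @ramsey_transitive T T id _ D (fun _ _ e => e) leD.
have pos_lt (i : 'I_q) (w : W) : i * #|{: W}| + enum_rank w < size s.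
  rewrite ss; apply: (@leq_trans (i.+1 * #|{: W}|)); last by rewrite leq_mul.
  by rewrite mulSn addnC ltn_add2r ltn_ord.
have [x0 x0D | D0] := pickP [in D]; last first.
  have c0 : #|D| = 0 by apply: eq_card0.
  by move: leD; rewrite c0 leqn0 expn_eq0.
pose xx (i : 'I_q) (w : W) := nth x0 s (i * #|{: W}| + enum_rank w).
have xxD i w : xx i w \in D by apply/sD/mem_nth/pos_lt.
have xx_arc (i i' : 'I_q) w w' : i < i' -> arc (xx i w) (xx i' w').
  move=> lti; apply: (pairwiseP x0 ps); rewrite ?inE ?pos_lt //.
  apply: (@leq_trans (i.+1 * #|{: W}|)); first by rewrite mulSn addnC ltn_add2r ltn_ord.
  by apply: leq_trans (leq_addr _ _); rewrite leq_mul.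
have us : uniq s.
  by apply: pairwise_uniq ps => x; rewrite arc_irr.
have xx_inj (i : 'I_q) w w' : xx i w = xx i w' -> w = w'.
  move/eqP; rewrite nth_uniq ?pos_lt // eqn_add2l => /eqP /val_inj.
  exact: enum_rank_inj.
(* Vertex [xx i w] stands in block [i] with prescribed trace [w.2]: dominating [v j] will mean
   [j \in w.2]. *)
pose E (j : 'I_N) := [set xx iw.1 iw.2 | iw in [set iw : 'I_q * W | j \in iw.2.2]].
have /fin_all_exists2[v vR vE] j : exists2 v, v \in R & forall x, x \in D -> darc x v = (x \in E j).
  by apply: sh; apply/subsetP => _ /imsetP[iw _ ->].
have xxE i w j : (xx i w \in E j) = (j \in w.2).
  apply/imsetP/idP => [[[i' w']]|jw]; last by exists (i, w); rewrite ?inE.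
  rewrite inE /= => jw' eqx.
  have eqi : i = i'.
    apply: ord_inj; case: (ltngtP i i') => // lt.
      by have := xx_arc _ _ w w' lt; rewrite eqx arc_irr.
    by have := xx_arc _ _ w' w lt; rewrite eqx arc_irr.
  by move: eqx; rewrite eqi => /xx_inj ->.
have [h0|ltq] := posnP q.
  apply/embedsP; exists (fun=> x0) => [x|x y]; first by rewrite inE x0D.
  by have := max_card (pred1 x); rewrite card1 [#|H|]h0.
have inj_v : injective v.
  move=> j j' eqv; pose w : W := (ord0, [set j]).
  have := xxE (Ordinal ltq) w j; rewrite -vE // eqv vE // xxE /= !inE eqxx.
  by move/eqP.
have [u [su _ pu]] := @ramsey_transitive _ T v q setT inj_v (ltac:(by rewrite cardsT card_ord)).
have j0 : 'I_N by exists 0; rewrite expn_gt0.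
pose uu (l : 'I_q) := nth j0 u l.
have uu_arc (l l' : 'I_q) : l < l' -> arc (v (uu l)) (v (uu l')).
  by move=> ltl; apply: (pairwiseP j0 pu); rewrite ?inE ?su.
have uu_inj : injective uu.
  move=> l l' eql; apply: ord_inj; case: (ltngtP l l') => // lt.
    by have := uu_arc _ _ lt; rewrite eql arc_irr.
  by have := uu_arc _ _ lt; rewrite eql arc_irr.
have r_inj x y : f x = f y -> r x = r y -> x = y.
  move=> eqf eqr; apply/eqP; apply: contraT => /arc_xor.
  case xy: (arc x y) => /= yx; first by have := rlt _ _ eqf xy; rewrite eqr ltnn.
  by have := rlt _ _ (esym eqf) yx; rewrite eqr ltnn.
pose S h := [set j : 'I_N | [exists h', [&& ~~ f h', j == uu (r h') & arc h h']]].
have avoid h : exists c : 'I_N.+1, forall j, xx (r h) (c, S h) != v j.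
  suff /existsP[c /forallP cP] : [exists c : 'I_N.+1, forall j, xx (r h) (c, S h) != v j].
    by exists c.
  apply: contraT => /existsPn no.
  have /fin_all_exists[k kP] (c : 'I_N.+1) : exists j, xx (r h) (c, S h) = v j.
    have := no c; rewrite negb_forall => /existsP[j]; rewrite negbK => /eqP; by exists j.
  have inj_k : injective k.
    by move=> c c' eqk; have := kP c; rewrite eqk -kP => /xx_inj [].
  by have := leq_card _ inj_k; rewrite !card_ord ltnn.
have /fin_all_exists[c cP] := avoid.
pose g h := if f h then xx (r h) (c h, S h) else v (uu (r h)).
apply/embedsP; exists g => [h|h h' hh']; first by rewrite inE /g; case: (f h); rewrite ?xxD ?vR ?orbT.
rewrite /g; case fh: (f h); case fh': (f h').
- by apply/xx_arc/rlt; rewrite ?fh ?fh'.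
- rewrite -darc_arc // vE // xxE /= inE.
  by apply/existsP; exists h'; rewrite fh' eqxx.
- rewrite -darcN vE // xxE /= inE; apply/existsP => -[h'' /and3P[fh'' /eqP /uu_inj eqr h'h'']].
  have eqh : h = h'' by apply: r_inj => //; rewrite fh (negPf fh'').
  by rewrite -eqh (arc_asym hh') in h'h''.
- by apply/uu_arc/rlt; rewrite ?fh ?fh'.
Qed.

(** * Heroes are 2-colourable *)

(** A failure would close [x], [y], [z] into a directed triangle. *)
Lemma acyclic_trans (T : tournament) (F : {set T}) : acyclic (induced F) ->
  {in F & &, forall x y z, arc x y -> arc y z -> arc x z}.
Proof.
move=> /acyclicP noc x y z xF yF zF xy yz; apply: contraT; rewrite -darcN negbK /darc.
case/orP=> [/eqP eqzx|zx]; first by rewrite eqzx (arc_asym xy) in yz.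
have [] := noc [:: Sub x xF; Sub y yF; Sub z zF]; first by [].
apply/andP; split; first by rewrite /= /induced_arc /= xy yz zx.
rewrite -(map_inj_uniq val_inj) /= !inE negb_or (arc_neq xy) (arc_neq yz) /= andbT.
by rewrite eq_sym (arc_neq zx).
Qed.

Section BackArcs.
Variables (V : finType) (key : V -> nat) (sh : rel V).
Hypotheses (key_inj : injective key) (sh_key : forall x y, sh x y -> key x < key y).

(** The tournament ordered by [key] whose back arcs are exactly the reversed pairs of [sh]. *)
Definition back_arc : rel V := fun x y =>
  if key x < key y then ~~ sh x y else (key y < key x) && sh y x.

Lemma back_arc_irr : irreflexive back_arc.
Proof. by move=> x; rewrite /back_arc ltnn. Qed.

Lemma back_arc_xor x y : x != y -> back_arc x y (+) back_arc y x.
Proof.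
rewrite -(inj_eq key_inj) /back_arc; case: (ltngtP (key x) (key y)) => //= _ _.
  by case: (sh x y).
by case: (sh y x).
Qed.

Definition back_tournament := Tournament back_arc_irr back_arc_xor.

Lemma back_arc_sh x y : sh x y -> back_arc y x.
Proof. by move=> xy; rewrite /back_arc ltnNge ltnW ?sh_key //= xy. Qed.

(* In a transitive set, no vertex is both the start and the end of a back arc. *)
Lemma colorable_back (m : nat) :
  (forall x y z, sh x y -> sh y z -> ~~ sh x z) -> colorable back_tournament m ->
  exists f : V -> 'I_m * bool, forall x y, sh x y -> f x != f y.
Proof.
move=> no_tri /existsP[F /andP[/forallP Fac /eqP FT]].
have /fin_all_exists[i iP] (x : V) : exists i, x \in F i.
  have : x \in \bigcup_i F i by rewrite FT inE.
  by case/bigcupP=> i _ xi; exists i.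
(* The bit tells whether [x] starts an [sh] pair inside its class. If [x] and [y] agree, then [y]
   has such a pair to some [z], and transitivity along [z], [y], [x] would force [sh x z]. *)
exists (fun x => (i x, [exists y in F (i x), sh x y])) => x y xy.
apply/negP => /eqP[eqi]; have /existsP -> : exists y', (y' \in F (i x)) && sh x y'.
  by exists y; rewrite eqi iP xy.
move/esym/exists_inP=> [z zF yz].
have tr := acyclic_trans (Fac (i x)); rewrite -eqi in zF.
have yF : y \in F (i x) by rewrite eqi.
have : @arc back_tournament z x.
  by apply: (tr z y x) => //; apply: back_arc_sh.
apply/negP; rewrite /= /back_arc.
have ltxz := ltn_trans (sh_key xy) (sh_key yz).
by rewrite ltnNge ltnW //= ltxz (no_tri _ _ _ xy yz).
Qed.

(** Within a class of [b] no arc is a back arc, so all arcs there increase [key]. *)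
Lemma two_colorable_back (H : tournament) (g : H -> back_tournament) (b : H -> bool) :
  (forall x y, arc x y -> arc (g x) (g y)) ->
  (forall x y, sh (g x) (g y) -> b x != b y) -> two_colorable H.
Proof.
move=> ga gb; exists b => x y z bxy byz xy yz.
have noback u v : b u = b v -> arc u v -> key (g u) < key (g v).
  move=> buv /ga; rewrite /= /back_arc; case: ifP => // _ /andP[_ /gb].
  by rewrite buv eqxx.
rewrite -(arc_hom_eq ga) /= /back_arc.
rewrite (ltn_trans (noback _ _ bxy xy) (noback _ _ byz yz)).
by apply/negP => /gb; rewrite bxy byz eqxx.
Qed.
End BackArcs.

(** A proper colouring of the shift graph on increasing [k]-tuples below [n]: adjacent tuples are
    the initial and the final part of an increasing [k.+1]-tuple. *)
Definition shift_coloring (k n : nat) (C : finType) (c : seq nat -> C) : Prop :=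
  forall s, sorted ltn s -> size s = k.+1 -> all (gtn n) s -> c (take k s) != c (behead s).

(** Colour a [k]-tuple by the set of colours of its extensions at the end. The colour of a
    [k.+1]-tuple [s] lies in the set of its initial part; if it also lay in that of its final part,
    [s] and an adjacent tuple would share a colour. *)
Lemma shift_coloring_down k n (C : finType) (c : seq nat -> C) : 0 < k ->
  shift_coloring k.+1 n c -> exists c' : seq nat -> {set C}, shift_coloring k n c'.
Proof.
move=> k0 cP.
pose succ (s : seq nat) (a : C) (t : 'I_n) :=
  sorted ltn (rcons s (t : nat)) && (c (rcons s (t : nat)) == a).
exists (fun s => [set a | [exists t, succ s a t]]).
move=> s ss sz sn; apply/negP => /eqP/setP/(_ (c s)); rewrite !inE.
have yn : nth 0 s k < n by apply: (all_nthP 0 sn); rewrite sz.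
have eqs : rcons (take k s) (nth 0 s k) = s by rewrite -take_nth ?sz // -sz take_size.
have -> : [exists t, succ (take k s) (c s) t].
  by apply/existsP; exists (Ordinal yn); rewrite /succ /= eqs ss eqxx.
case/esym/existsP=> t /andP[st /eqP eqc].
have := cP (rcons s t); rewrite size_rcons all_rcons sn sz /= ltn_ord.
have -> : take k.+1 (rcons s t) = s by rewrite -cats1 take_cat sz ltnn subnn take0 cats0.
case: s ss sz st eqc {sn eqs yn} => [|x [|x' s]] //= ss sz st eqc.
  by case: sz k0 => <-.
case/andP: ss => xx' _; rewrite xx' st /= in eqc * => /(_ isT erefl isT).
by rewrite -eqc eqxx.
Qed.

Fixpoint tower k m := if k is k'.+1 then tower k' (2 ^ m) else m.

(** Each shortening of the tuples replaces the colours by sets of colours; on 1-tuples a proper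
    colouring is injective. *)
Lemma shift_coloring_tower k n (C : finType) (c : seq nat -> C) :
  shift_coloring k.+1 n c -> n <= tower k #|C|.
Proof.
elim: k C c => [|k IH] C c cP; last first.
  by have [c' /IH] := shift_coloring_down (ltn0Sn k) cP; rewrite -cardsT -powersetT card_powerset cardsT.
have inj_c : injective (fun i : 'I_n => c [:: i : nat]).
  have ne (i j : 'I_n) : i < j -> c [:: i : nat] != c [:: j : nat].
    by move=> ij; apply: (cP [:: i : nat; j : nat]); rewrite /= ?ij ?ltn_ord.
  move=> i j /eqP eqc; apply: ord_inj; case: (ltngtP i j) => // lt.
    by have := ne _ _ lt; rewrite eqc.
  by have := ne _ _ lt; rewrite eq_sym eqc.
by rewrite /= -[leqLHS]card_ord; apply: leq_card inj_c.
Qed.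

Section Shift.
Variables (n k : nat).
Hypothesis k2 : 1 < k.

Definition tup := {t : k.-tuple 'I_n | sorted ltn (map val t)}.
Definition entries (x : tup) : seq nat := map val (val x).

Lemma size_entries x : size (entries x) = k.
Proof. by rewrite size_map size_tuple. Qed.

Lemma entries_inj : injective entries.
Proof. by move=> x y /(inj_map val_inj) /val_inj /val_inj. Qed.

Lemma sorted_entries x : sorted ltn (entries x).
Proof. exact: (valP x). Qed.

Lemma entries_surj s : size s = k -> sorted ltn s -> all (gtn n) s -> exists x, entries x = s.
Proof.
move=> sz ss sn; have [t tE] : exists t : seq 'I_n, map val t = s.
  elim: s sn {sz ss} => [|a s IH] /=; first by exists [::].
  by case/andP=> an /IH[t <-]; exists (Ordinal an :: t).
have szt : size t == k by rewrite -sz -tE size_map.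
have st : sorted ltn (map val (Tuple szt)) by rewrite tE.
by exists (Sub (Tuple szt) st).
Qed.

Definition shift : rel tup := fun x y => behead (entries x) == take k.-1 (entries y).

(** The first entry decides and the enumeration breaks ties; a shift raises the first entry, so
    shifts point upwards. *)
Definition key (x : tup) : nat := nth 0 (entries x) 0 * #|{: tup}| + enum_rank x.

Lemma key_lt x y : nth 0 (entries x) 0 < nth 0 (entries y) 0 -> key x < key y.
Proof.
move=> lt; rewrite /key; apply: leq_trans (leq_addr _ _).
apply: (@leq_trans ((nth 0 (entries x) 0).+1 * #|{: tup}|)); last by rewrite leq_mul.
by rewrite mulSn addnC ltn_add2r.
Qed.

Lemma key_inj : injective key.
Proof.
move=> x y eqk; apply: enum_rank_inj; apply: ord_inj.
have eqh : nth 0 (entries x) 0 = nth 0 (entries y) 0.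
  by case: (ltngtP (nth 0 (entries x) 0) (nth 0 (entries y) 0)) => // /key_lt; rewrite eqk ltnn.
by move: eqk; rewrite /key eqh => /addnI.
Qed.

Lemma nth_shift x y i : shift x y -> i.+1 < k -> nth 0 (entries y) i = nth 0 (entries x) i.+1.
Proof.
move=> /eqP eqs lti; have /(congr1 (nth 0 ^~ i)) := eqs.
by rewrite nth_behead nth_take //; case: k lti.
Qed.

Lemma entries_lt x i j : i < j -> j < k -> nth 0 (entries x) i < nth 0 (entries x) j.
Proof.
move=> ij jk; apply: (sorted_ltn_nth ltn_trans 0 (sorted_entries x)) => //.
  by rewrite inE size_entries (ltn_trans ij).
by rewrite inE size_entries.
Qed.

Lemma shift_key x y : shift x y -> key x < key y.
Proof. by move=> xy; apply: key_lt; rewrite (nth_shift xy) // entries_lt. Qed.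

(** The first two entries of [y] would both equal the second entry of [x]. *)
Lemma shift_no_tri x y z : shift x y -> shift y z -> ~~ shift x z.
Proof.
move=> xy yz; apply/negP => xz; have := entries_lt y (ltnSn 0) k2.
by rewrite -(nth_shift yz) // (nth_shift xz) // (nth_shift xy) // ltnn.
Qed.

Definition shift_tournament := back_tournament shift key_inj.

Lemma colorable_shift m : colorable shift_tournament m -> n <= tower k.-1 (m * 2).+1.
Proof.
move=> /(colorable_back shift_key shift_no_tri)[f fP].
(* [None] colours the sequences that come from no tuple; it accounts for the successor in
   [(m * 2).+1]. *)
pose c (s : seq nat) := omap f [pick x | entries x == s].
have cE x : c (entries x) = Some (f x).
  rewrite /c; case: pickP => [y /eqP/entries_inj -> //|/(_ x)]; by rewrite eqxx.
have cP : shift_coloring k.-1.+1 n c.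
  move=> s ss sz sn; have k0 : k.-1.+1 = k by rewrite prednK // ltnW.
  rewrite k0 in sz *.
  have [x xE] : exists x, entries x = take k s.
    apply: entries_surj; first by rewrite size_takel // sz.
      exact: take_sorted.
    by apply/allP => a /mem_take; apply/allP.
  have [y yE] : exists y, entries y = behead s.
    apply: entries_surj; first by rewrite size_behead sz.
      by rewrite -drop1 drop_sorted.
    by apply/allP => a /mem_behead; apply/allP.
  rewrite -xE -yE !cE; apply/eqP => -[]; apply/eqP/fP.
  rewrite /shift xE yE; apply/eqP; case: s {ss sz sn xE yE} => [|a s] //=.
  by rewrite -{1}k0.
by have := shift_coloring_tower cP; rewrite card_option card_prod card_ord card_bool.
Qed.

(** Every step of the path moves a fixed entry by one position; [i] is the room for the remaining
    steps on both sides of [j]. *)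
Lemma shift_path (H : tournament) (g : H -> tup) (e : rel H) (v : H) (p : seq H) (i j : nat) :
  (forall x y, e x y -> shift (g x) (g y) || shift (g y) (g x)) ->
  path e v p -> size p <= i -> i <= j -> j + i < k ->
  exists2 j', j' < k & nth 0 (entries (g (last v p))) j' = nth 0 (entries (g v)) j.
Proof.
move=> esh; elim: p v i j => [|w p IH] v i j /=.
  by move=> _ _ _ ltk; exists j => //; apply: leq_ltn_trans ltk; apply: leq_addr.
case/andP=> /esh vw pw; case: i => // i; rewrite ltnS => lei lej ltk.
case/orP: vw => sh.
  case: j lej ltk => // j lej ltk; have [||j' j'k eqj] := IH w i j pw lei; try lia.
  by exists j' => //; rewrite eqj (nth_shift sh) //; lia.
have [||j' j'k eqj] := IH w i j.+1 pw lei; try lia.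
by exists j' => //; rewrite eqj -(nth_shift sh) //; lia.
Qed.

(* All tuples of a connected component of at most k / 2 tuples share the middle entry of one of
   them; a shift moves its position by one, so the parity of that position is a 2-colouring. *)
Lemma two_colorable_shift (H : tournament) (g : H -> shift_tournament) :
  #|H| + #|H| < k -> (forall x y, arc x y -> arc (g x) (g y)) -> two_colorable H.
Proof.
move=> ltk ga; pose e : rel H := fun x y => shift (g x) (g y) || shift (g y) (g x).
have es : connect_sym e by apply: sym_connect_sym => x y; rewrite /e orbC.
pose z h := nth 0 (entries (g (fingraph.root e h))) #|H|.
have zin h : z h \in entries (g h).
  have : connect e (fingraph.root e h) h by rewrite es connect_root.
  case/connectP=> p0 /shortenP[p pp up _] eqh.
  have [] := @shift_path H g e (fingraph.root e h) p #|H| #|H|.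
  - by [].
  - exact: pp.
  - by have := max_card (mem p); rewrite (card_uniqP _) //; case/andP: up.
  - by [].
  - by [].
  by move=> j jk; rewrite -eqh /z => <-; rewrite mem_nth // size_entries.
apply: (two_colorable_back ga (b := fun h => odd (index (z h) (entries (g h))))) => x y sh.
have eqz : z x = z y.
  by rewrite /z; have /eqP -> : fingraph.root e x == fingraph.root e y; rewrite ?root_connect // connect1 // /e sh.
have zx := zin x; have zy := zin y; rewrite eqz in zx *.
have iy : index (z y) (entries (g y)) < k by rewrite -(size_entries (g y)) index_mem.
have ix : index (z y) (entries (g x)) < k by rewrite -(size_entries (g x)) index_mem.
have uniq_e w : uniq (entries w) by apply: sorted_uniq ltn_trans ltnn _ (sorted_entries w).
suff -> : index (z y) (entries (g x)) = (index (z y) (entries (g y))).+1.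
  by rewrite /=; case: (odd _).
have [lti|] := ltnP (index (z y) (entries (g y))).+1 k.
  rewrite -{1}(nth_index 0 zy) (nth_shift sh) // index_uniq // size_entries //.
(* Otherwise [z y] is the last entry of [g y], which exceeds every entry of [g x]. *)
move=> gei; have eqi : index (z y) (entries (g y)) = k.-1 by lia.
have := entries_lt (g y); set i := index (z y) (entries (g x)) in ix *.
have zE : nth 0 (entries (g y)) k.-1 = nth 0 (entries (g x)) i by rewrite -eqi !nth_index.
case: (posnP i) => [i0|i0] lt_e.
  have : nth 0 (entries (g x)) 0 < nth 0 (entries (g x)) 1 by apply: entries_lt.
  rewrite -(nth_shift sh) //; have := lt_e 0 k.-1; rewrite zE i0; lia.
have := lt_e i.-1 k.-1; rewrite zE (nth_shift sh) ?prednK //; lia.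
Qed.
End Shift.

(** With [k] above twice the order of [H] and [n] above the tower bounds for all [m < c], the shift
    tournament has chromatic number at least [c]; so [H] appears in it, and so small a piece is
    2-colourable. *)
Lemma hero_two_colorable (H : tournament) : hero H -> two_colorable H.
Proof.
case=> c c0 cP; pose k := (#|H| + #|H|).+2.
pose n := (\max_(m < c) tower k.-1 (m * 2).+1).+1.
have k2 : 1 < k by [].
pose T := shift_tournament n k.
have /embedsP[g _ ga] : embeds H [set: T].
  apply: contraT => nemb; have freeT : free H T.
    by apply: not_free_hom => -[g ga]; case/embedsP: nemb; exists g.
  have lt := cP T freeT.
  have colT : colorable T (chi T) by rewrite /chi; case: ex_minnP.
  have := colorable_shift k2 colT; rewrite leqNgt ltnS.
  by rewrite (leq_bigmax (Ordinal lt)).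
exact: (two_colorable_shift k2 _ ga).
Qed.

Import Order.TTheory GRing.Theory Num.Theory.

(** * Monochromatic copies in large sets *)

Lemma sum_bool_card (I : finType) (b : pred I) : \sum_i (b i : nat) = #|[set i | b i]|.
Proof. by rewrite -sum1dep_card [RHS]big_mkcond; apply: eq_bigr => i _; case: (b i). Qed.

Lemma card_agree (I : finType) (f : {ffun I -> bool}) (J : {set I}) :
  #|[set g : {ffun I -> bool} | [forall i in J, g i == f i]]| <= 2 ^ (#|I| - #|J|).
Proof.
have -> : #|I| - #|J| = #|~: J| by have := cardsC J; lia.
rewrite -card_powerset.
pose h (g : {ffun I -> bool}) := [set i in ~: J | g i].
rewrite -(card_in_imset (f := h)).
  by apply: subset_leq_card; apply/subsetP => _ /imsetP[g _ ->]; rewrite inE; apply/subsetP => i;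
     rewrite !inE => /andP[].
move=> g1 g2; rewrite !inE => /forall_inP g1f /forall_inP g2f /setP eqh.
apply/ffunP => i; have [iJ|iJ] := boolP (i \in J).
  by rewrite (eqP (g1f i iJ)) (eqP (g2f i iJ)).
by have := eqh i; rewrite !inE iJ.
Qed.

(* [sg] swaps the pairs y (i, false), y (i, true); a vertex [v sg] beats one element of every
   pair, and if it is often beaten by the other one then few [sg] share the same trace. *)
Lemma trace_embeds (H : tournament) (m : nat) : two_colorable H -> 0 < m ->
  exists2 s, 0 < s & forall (T : tournament) (y : 'I_s * bool -> T)
      (v : {ffun 'I_s -> bool} -> T) (C : {set T}),
    (forall (sg : {ffun 'I_s -> bool}) i, arc (v sg) (y (i, sg i))) ->
    s * 2 ^ s <= m * \sum_(sg : {ffun 'I_s -> bool}) \sum_i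
      [&& darc (y (i, ~~ sg i)) (v sg), y (i, ~~ sg i) \in C & v sg \in C] ->
    embeds H ((y @: setT :|: v @: setT) :&: C).
Proof.
move=> /shattered_embeds[d dP] m0.
have [t tP] := exp_beats_poly d (4 * m).
have t0 : 0 < t by case: t tP => //; rewrite muln0 exp1n muln1 expn0; lia.
(* With [s = 2 * m * t] the inner sum is at least [2 * t] on average, so at least a proportion
   [1 / (2 * m)] of the [sg] have [v sg] in [C] and a trace of at least [t] elements. *)
exists (2 * m * t) => [|T y v C vy]; first by rewrite !muln_gt0 m0 t0.
set s := 2 * m * t in y v vy *; move=> leS.
have s0 : 0 < s by rewrite !muln_gt0 m0 t0.
pose tr (sg : {ffun 'I_s -> bool}) := [set k | (y k \in C) && darc (y k) (v sg)].
have tr_sg sg i b : (i, b) \in tr sg -> b = ~~ sg i.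
  rewrite inE => /andP[_]; apply: contraTeq => neb; rewrite darcN.
  by have -> : b = sg i by case: b neb; case: (sg i).
pose n (sg : {ffun 'I_s -> bool}) := \sum_i [&& darc (y (i, ~~ sg i)) (v sg), y (i, ~~ sg i) \in C & v sg \in C].
have n_tr sg : n sg <= #|tr sg|.
  rewrite /n sum_bool_card -(card_imset (f := fun i => (i, ~~ sg i))); last by move=> i j [].
  apply: subset_leq_card; apply/subsetP => _ /imsetP[i + ->]; rewrite !inE.
  by case/and3P=> -> ->.
have n_s sg : n sg <= s.
  rewrite -[leqRHS]card_ord /n sum_bool_card -cardsT; exact: subset_leq_card (subsetT _).
pose G := [set sg | (v sg \in C) && (t <= #|tr sg|)].
have n_nG sg : sg \notin G -> n sg <= t.
  rewrite inE negb_and => /orP[vC|].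
    by rewrite /n big1 // => i _; rewrite (negPf vC) !andbF.
  by rewrite -ltnNge => /ltnW; apply: leq_trans.
have cs : #|{ffun 'I_s -> bool}| = 2 ^ s by rewrite card_ffun card_bool card_ord.
have leG : 2 ^ s <= 2 * m * #|G|.
  have : \sum_sg n sg <= #|G| * s + 2 ^ s * t.
    rewrite (bigID (mem G)) /= leq_add //.
      by rewrite -sum_nat_const leq_sum.
    rewrite -cs -sum_nat_const big_mkcond /= leq_sum // => sg _.
    by case: ifP => // /n_nG.
  move: leS; rewrite -/(n _) => le1 le2.
  have : s * 2 ^ s <= m * (#|G| * s + 2 ^ s * t).
    by apply: leq_trans le1 _; rewrite leq_mul2l le2 orbT.
  move=> le3.
  have e1 : 2 * (m * (2 ^ s * t)) = s * 2 ^ s by rewrite /s; ring.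
  have e2 : 2 * (m * (#|G| * s)) = s * (2 * m * #|G|) by ring.
  rewrite -(leq_pmul2l s0).
  suff : 2 * (s * 2 ^ s) <= s * (2 * m * #|G|) + s * 2 ^ s by rewrite mul2n -addnn leq_add2r.
  apply: (@leq_trans (2 * (m * (#|G| * s + 2 ^ s * t)))); first by rewrite leq_mul2l le3.
  by rewrite !mulnDr e1 e2.
(* A trace determines [sg] on the coordinates it meets, at least [t] of them. *)
have fib sg0 : sg0 \in G -> #|[set sg in G | tr sg == tr sg0]| <= 2 ^ (s - t).
  rewrite inE => /andP[_ le_t].
  pose J := [set k.1 | k in tr sg0].
  have cJ : #|J| = #|tr sg0|.
    rewrite card_in_imset // => -[i b] [j c] /tr_sg -> /tr_sg -> /= -> //.
  apply: leq_trans (subset_leq_card _) (leq_trans (card_agree sg0 J) _).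
    apply/subsetP => sg; rewrite !inE => /andP[_ /eqP eqtr].
    apply/forall_inP => _ /imsetP[[i b] ib ->] /=.
    have := tr_sg _ _ _ ib; rewrite -eqtr in ib; rewrite (tr_sg _ _ _ ib).
    by case: (sg i); case: (sg0 i).
  by rewrite card_ord leq_exp2l // cJ leq_sub2l.
have leGF : #|G| <= #|tr @: G| * 2 ^ (s - t).
  rewrite -sum1_card (partition_big_imset tr) /= -sum_nat_const leq_sum // => F /imsetP[sg0 sg0G ->].
  apply: leq_trans (fib _ sg0G); rewrite sum1_card -cardsE.
  by apply: subset_leq_card; apply/subsetP => sg; rewrite !inE.
have leF : 2 ^ t <= 2 * m * #|tr @: G|.
  rewrite -(leq_pmul2r (expn_gt0 2 (s - t))) -expnD subnKC; last first.
    by rewrite /s leq_pmull // muln_gt0.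
  by apply: leq_trans leG _; rewrite -[leqRHS]mulnA leq_mul2l leGF orbT.
have ltF : #|{: 'I_s * bool}|.+1 ^ d < #|tr @: G|.
  rewrite card_prod card_ord card_bool.
  have eqs : s * 2 = 4 * m * t by rewrite /s; ring.
  rewrite eqs -(ltn_pmul2l (m := 4 * m)) ?muln_gt0 //.
  apply: leq_trans tP _; apply: leq_trans leF _; rewrite leq_mul2r leq_mul2r; lia.
have [D /shattersP shD ltD] := sauer_shelah ltF.
have Dy k : k \in D -> y k \in C.
  move=> kD; have [_ /imsetP[sg _ ->] /setP/(_ k)] := shD D (subxx D).
  by rewrite !inE kD andbT => /andP[].
have trD sg k : k \in D -> darc (y k) (v sg) = (k \in tr sg).
  by move=> kD; rewrite inE Dy.
have y_inj : {in D &, injective y}.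
  move=> k k' kD k'D eqy; have sk : [set k] \subset D by rewrite sub1set.
  have [_ /imsetP[sg _ ->] /setP trE] := shD _ sk.
  have := trE k'; rewrite in_setI k'D andbT -trD // -eqy trD // => e1.
  by have := trE k; rewrite in_setI kD andbT e1 !inE eqxx => /eqP.
apply: (@embedsS _ _ (y @: D :|: v @: G)).
  apply/subsetP => x /setUP[] /imsetP[z zin ->]; rewrite !inE.
    by rewrite imset_f ?inE //= Dy.
  by rewrite imset_f ?inE ?orbT //=; move: zin; rewrite inE => /andP[].
apply: dP; first by rewrite card_in_imset // ltnW.
move=> E sED; have sE : [set k in D | y k \in E] \subset D.
  by apply/subsetP => k; rewrite inE => /andP[].
have [_ /imsetP[sg sgG ->] /setP trE] := shD _ sE.
exists (v sg); first exact: imset_f.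
move=> _ /imsetP[k kD ->]; rewrite trD //.
by have := trE k; rewrite in_setI kD andbT inE kD.
Qed.

(** The set [X] ranges over all vertices, not only those of [A], so largeness passes to supersets
    and can be split over a union; at [K = 0] it says that [A] is nonempty. *)
Definition large (T : tournament) (K : nat) (A : {set T}) : bool :=
  [forall X : {set T}, (#|X| <= K) ==> [exists a in A, [forall x in X, arc a x]]].

Section Large.
Variable T : tournament.
Implicit Types (A B C X : {set T}) (K : nat).

Lemma largeP K A :
  reflect (forall X, #|X| <= K -> exists2 a, a \in A & forall x, x \in X -> arc a x) (large K A).
Proof.
apply: (iffP forallP) => h X.
  by move=> leX; have /implyP/(_ leX)/exists_inP[a aA /forall_inP] := h X; exists a.
apply/implyP => /h[a aA ax]; apply/exists_inP; exists a => //; exact/forall_inP.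
Qed.

Lemma largeW K K' A : K' <= K -> large K A -> large K' A.
Proof. by move=> le /largeP h; apply/largeP => X leX; apply: h; apply: leq_trans le. Qed.

Lemma largeN K A : ~~ large K A ->
  exists2 X : {set T}, #|X| <= K & forall a, a \in A -> exists2 x, x \in X & darc x a.
Proof.
rewrite negb_forall => /existsP[X]; rewrite negb_imply => /andP[leX /exists_inPn no].
exists X => // a /no; rewrite negb_forall_in => /exists_inP[x xX nax]; exists x => //.
by rewrite -[darc x a]negbK darcN.
Qed.

(** If [X] dominates [B], a vertex of [A] that beats [X :|: Y] lies in [C]. *)
Lemma large_split K K' A B C : A \subset B :|: C -> large (K + K') A -> ~~ large K B -> large K' C.
Proof.
move=> /subsetP sub /largeP lA /largeN[X leX Xd]; apply/largeP => Y leY.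
have [|a aA aXY] := lA (X :|: Y).
  by rewrite cardsU; apply: leq_trans (leq_subr _ _) _; apply: leq_add.
have /setUP[/Xd[x xX]|aC] := sub a aA.
  by rewrite -[darc x a]negbK darcN aXY // inE xX.
by exists a => // y yY; apply: aXY; rewrite inE yY orbT.
Qed.

(** Serves to find a later copy all of whose vertices beat a given earlier copy [X]. *)
Lemma large_beating K X A : large (K + #|X|) A -> large K [set a in A | [forall x in X, arc a x]].
Proof.
move=> /largeP lA; apply/largeP => Y leY; have [|a aA aXY] := lA (X :|: Y).
  by rewrite cardsU; apply: leq_trans (leq_subr _ _) _; rewrite addnC leq_add2r.
exists a => [|y yY]; last by apply: aXY; rewrite inE yY orbT.
by rewrite inE aA; apply/forall_inP => x xX; apply: aXY; rewrite inE xX.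
Qed.

Lemma large_neq0 K A : large K A -> exists a, a \in A.
Proof. by move=> /largeP/(_ set0)[|a aA _]; rewrite ?cards0 //; exists a. Qed.

End Large.

Local Open Scope ring_scope.

(** * Linear programming duality over the rationals *)

Lemma exists_between (sl su : seq rat) :
    (forall x y, x \in sl -> y \in su -> x < y) ->
  exists t, (forall x, x \in sl -> x < t) /\ (forall y, y \in su -> t < y).
Proof.
have exmax (s : seq rat) x0 : exists2 m, m \in x0 :: s & forall x, x \in x0 :: s -> x <= m.
  elim: s x0 => [|a s IH] x0.
    by exists x0; rewrite ?mem_head // => x; rewrite inE => /eqP ->.
  have [m m_in m_max] := IH a; case: (lerP x0 m) => cmp.
    exists m; first by rewrite inE m_in orbT.
    by move=> x; rewrite inE => /orP[/eqP -> //|/m_max].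
  exists x0; rewrite ?mem_head // => x; rewrite inE => /orP[/eqP -> //|/m_max le].
  exact: le_trans le (ltW cmp).
have exmin (s : seq rat) x0 : exists2 m, m \in x0 :: s & forall x, x \in x0 :: s -> m <= x.
  have [m m_in m_max] := exmax (map -%R s) (- x0).
  exists (- m).
    by rewrite -(mem_map oppr_inj) opprK.
  by move=> x x_in; rewrite lerNl; apply: m_max; rewrite -map_cons (mem_map oppr_inj).
case: sl => [|a sl] lt_lu.
  case: su lt_lu => [|b su] _; first by exists 0.
  have [m m_in m_min] := exmin su b; exists (m - 1); split=> // y /m_min; lra.
have [M M_in M_max] := exmax sl a.
case: su lt_lu => [|b su] lt_lu.
  exists (M + 1); split=> // x /M_max; lra.
have [m m_in m_min] := exmin su b.
have ltMm := lt_lu _ _ M_in m_in.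
by exists ((M + m) / 2); split=> [x /M_max|y /m_min]; lra.
Qed.

(** Combinations, with nonnegative coefficients not all zero, of the rows allowed by [P]; excluding
    zero lets the coefficients be normalised to a distribution. *)
Inductive cone (I J : Type) (P : pred I) (M : I -> J -> rat) : (J -> rat) -> Prop :=
| cone_gen i : P i -> cone P M (M i)
| cone_add f g : cone P M f -> cone P M g -> cone P M (fun j => f j + g j)
| cone_scale a f : 0 < a -> cone P M f -> cone P M (fun j => a * f j).

Lemma cone_trans (I I' J : Type) (P : pred I) (P' : pred I') (M : I -> J -> rat)
    (M' : I' -> J -> rat) f :
  (forall i, P' i -> cone P M (M' i)) -> cone P' M' f -> cone P M f.
Proof.
move=> sub; elim=> [i /sub //|f1 g1 _ cf _ cg|a f1 a0 _ cf].
- exact: cone_add.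
- exact: cone_scale.
Qed.

Lemma cone_ge0 (I J : Type) (P : pred I) (M : I -> J -> rat) j f :
  (forall i, P i -> 0 <= M i j) -> cone P M f -> 0 <= f j.
Proof.
move=> ge0; elim=> [i /ge0 //|f1 g1 _ cf _ cg|a f1 a0 _ cf].
- exact: addr_ge0.
- by rewrite mulr_ge0 // ltW.
Qed.

Lemma cone_coef (I : finType) (J : Type) (P : pred I) (M : I -> J -> rat) f :
  cone P M f -> exists p : I -> rat,
    [/\ forall i, 0 <= p i, forall i, ~~ P i -> p i = 0, 0 < \sum_i p i
      & forall j, f j = \sum_i p i * M i j].
Proof.
elim=> [i Pi|f1 g1 _ [p [p0 pP ps pM]] _ [q [q0 qP qs qM]]|a f1 a0 _ [p [p0 pP ps pM]]].
- exists (fun i' => (i' == i)%:R); split.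
  + by move=> i'; rewrite ler0n.
  + by move=> i' nP; case: eqP => // eq_i; rewrite eq_i Pi in nP.
  + rewrite (bigD1 i) //= eqxx big1 ?addr0 // => i' /negPf -> //.
  + move=> j; rewrite (bigD1 i) //= eqxx mul1r big1 ?addr0 // => i' /negPf ->.
    by rewrite mul0r.
- exists (fun i => p i + q i); split.
  + by move=> i; rewrite addr_ge0.
  + by move=> i nP; rewrite pP // qP // addr0.
  + by rewrite big_split addr_gt0.
  + move=> j; rewrite pM qM -big_split; apply: eq_bigr => i _ /=; ring.
- exists (fun i => a * p i); split.
  + by move=> i; rewrite mulr_ge0 // ltW.
  + by move=> i nP; rewrite pP // mulr0.
  + by rewrite -mulr_sumr mulr_gt0.
  + by move=> j; rewrite pM mulr_sumr; apply: eq_bigr => i _; rewrite mulrA.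
Qed.

(* Fourier-Motzkin elimination of one column at a time. *)
Lemma cone_alternative (J : eqType) (cols : seq J) (I : finType) (P : pred I)
    (M : I -> J -> rat) : uniq cols ->
  (exists2 f, cone P M f & forall j, j \in cols -> 0 <= f j) \/
  (exists2 mu : J -> rat, forall j, 0 <= mu j
     & forall i, P i -> \sum_(j <- cols) mu j * M i j < 0).
Proof.
elim: cols I P M => [|j0 cols IH] I P M /=.
  move=> _; case: (pickP P) => [i Pi|P0]; first by left; exists (M i); first exact: cone_gen.
  by right; exists (fun=> 0) => // i; rewrite P0.
case/andP=> j0_nin /IH {}IH.
(* Rows nonnegative at [j0] are kept; a positive and a negative row are combined so that column [j0]
   vanishes. *)
pose P' (x : I + I * I) := match x with
  | inl i => P i && (0 <= M i j0)
  | inr (i, k) => [&& P i, P k, 0 < M i j0 & M k j0 < 0] end.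
pose M' (x : I + I * I) := match x with
  | inl i => M i
  | inr (i, k) => fun j => M i j0 * M k j + (- M k j0) * M i j end.
have [[f cf f0]|[mu mu0 neg]] := IH _ P' M'.
  left; exists f.
    apply: cone_trans cf => -[i|[i k]] /=; first by case/andP=> Pi _; apply: cone_gen.
    case/and4P=> Pi Pk Mi Mk.
    by apply: cone_add; apply: cone_scale; rewrite ?oppr_gt0 //; apply: cone_gen.
  move=> j; rewrite inE => /orP[/eqP ->|/f0 //].
  apply: (cone_ge0 _ cf) => -[i|[i k]] /=; first by case/andP.
  by move=> _; rewrite mulNr mulrC subrr.
right; pose s i := \sum_(j <- cols) mu j * M i j.
have s_neg i : P i -> 0 <= M i j0 -> s i < 0.
  by move=> Pi Mi; have := neg (inl i); rewrite /= Pi Mi; apply.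
have s_pair i k : P i -> P k -> 0 < M i j0 -> M k j0 < 0 ->
    M i j0 * s k + (- M k j0) * s i < 0.
  move=> Pi Pk Mi Mk; have := neg (inr (i, k)); rewrite /= Pi Pk Mi Mk => /(_ isT).
  congr (_ < 0); rewrite /s !mulr_sumr -big_split; apply: eq_bigr => j _ /=; ring.
(* The weight of column [j0] must lie above 0 and the bounds of the rows negative there, and below
   those of the positive rows; the kept and combined rows make these bounds compatible. *)
pose sl := 0 :: [seq s k / (- M k j0) | k <- enum P & M k j0 < 0].
pose su := [seq - s i / M i j0 | i <- enum P & 0 < M i j0].
have [|t [tl tu]] := @exists_between sl su.
  move=> x y; rewrite inE => /orP[/eqP ->|].
    case/mapP=> i; rewrite mem_filter mem_enum => /andP[Mi Pi] ->.
    by rewrite divr_gt0 // oppr_gt0 s_neg // ltW.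
  case/mapP=> k; rewrite mem_filter mem_enum => /andP[Mk Pk] ->.
  case/mapP=> i; rewrite mem_filter mem_enum => /andP[Mi Pi] ->.
  have Mk' : 0 < - M k j0 by rewrite oppr_gt0.
  rewrite ltr_pdivrMr // mulrAC ltr_pdivlMr //.
  have := s_pair i k Pi Pk Mi Mk; lra.
exists (fun j => if j == j0 then t else mu j).
  by move=> j; case: eqP => // _; apply/ltW/tl; rewrite mem_head.
move=> i Pi; rewrite big_cons eqxx.
have -> : \sum_(j <- cols) (if j == j0 then t else mu j) * M i j = s i.
  rewrite big_seq_cond [RHS]big_seq_cond; apply: eq_bigr => j /andP[j_in _].
  by case: eqP => // eq_j; rewrite eq_j (negPf j0_nin) in j_in.
case: (ltrgt0P (M i j0)) => Mi.
- have : t < - s i / M i j0.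
    by apply: tu; apply/mapP; exists i => //; rewrite mem_filter Mi mem_enum.
  by rewrite ltr_pdivlMr //; lra.
- have Mi' : 0 < - M i j0 by rewrite oppr_gt0.
  have : s i / (- M i j0) < t.
    by apply: tl; rewrite inE; apply/orP; right; apply/mapP; exists i => //; rewrite mem_filter Mi mem_enum.
  by rewrite ltr_pdivrMr //; lra.
- by rewrite Mi mulr0 add0r s_neg // Mi.
Qed.

Definition distr (T : finType) (A : pred T) (p : T -> rat) : Prop :=
  [/\ forall x, 0 <= p x, forall x, ~~ A x -> p x = 0 & \sum_x p x = 1].

(** The cone alternative on the columns of [Q], with the row coefficients normalised and [mu]
    extended by 0. *)
Lemma minimax (I J : finType) (P : pred I) (Q : pred J) (M : I -> J -> rat) :
  (exists2 p, distr P p & forall j, Q j -> 0 <= \sum_i p i * M i j) \/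
  (exists2 mu : J -> rat, (forall j, 0 <= mu j) /\ (forall j, ~~ Q j -> mu j = 0)
     & forall i, P i -> \sum_j mu j * M i j < 0).
Proof.
have [[f cf f0]|[mu mu0 neg]] := cone_alternative P M (enum_uniq Q).
  left; have [p [p0 pP ps pM]] := cone_coef cf.
  exists (fun i => p i / \sum_i p i).
    split=> [i|i nP|].
    - by rewrite divr_ge0 // ltW.
    - by rewrite pP // mul0r.
    - by rewrite -mulr_suml divff // gt_eqF.
  move=> j Qj; rewrite (eq_bigr (fun i => (\sum_i p i)^-1 * (p i * M i j))); last first.
    by move=> i _; ring.
  by rewrite -mulr_sumr -pM mulr_ge0 ?invr_ge0 ?(ltW ps) // f0 // mem_enum.
right; exists (fun j => if Q j then mu j else 0).
  by split=> j; [case: ifP | move/negPf=> ->].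
move=> i Pi; have := neg i Pi; rewrite big_enum /= big_mkcond /=.
by congr (_ < 0); apply: eq_bigr => j _; rewrite unfold_in; case: (Q j); rewrite ?mul0r.
Qed.

(** * Independent samples and monochromatic copies *)

Section Sampling.
Variables (K T : finType) (p : T -> rat).
Hypothesis p1 : \sum_t p t = 1.

Definition update (y : {ffun K -> T}) k t : {ffun K -> T} :=
  [ffun k' => if k' == k then t else y k'].

Definition weight (y : {ffun K -> T}) : rat := \prod_k p (y k).

Lemma weight_sum : \sum_y weight y = 1.
Proof.
by rewrite /weight -(bigA_distr_bigA (fun _ t => p t)) big1.
Qed.

Lemma weight_update y k t : weight (update y k t) * p (y k) = weight y * p t.
Proof.
rewrite /weight (bigD1 k) //= [in RHS](bigD1 k) //= ffunE eqxx.
rewrite (eq_bigr (fun i => p (y i))) => [|i /negPf ne]; last by rewrite ffunE ne.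
ring.
Qed.

(* The coordinate k may be resampled independently of the others. *)
Lemma resample k (g : T -> {ffun K -> T} -> rat) :
  (forall t y t', g t (update y k t') = g t y) ->
  \sum_y weight y * g (y k) y = \sum_y weight y * \sum_t p t * g t y.
Proof.
move=> gk.
have -> : \sum_y weight y * g (y k) y = \sum_y \sum_t weight y * p t * g (y k) y.
  apply: eq_bigr => y _; rewrite -mulr_suml -mulr_sumr p1 mulr1 //.
have -> : \sum_y weight y * (\sum_t p t * g t y) = \sum_y \sum_t weight y * p t * g t y.
  by apply: eq_bigr => y _; rewrite mulr_sumr; apply: eq_bigr => t _; rewrite mulrA.
rewrite !pair_bigA /=.
(* Exchanging coordinate [k] with the fresh sample preserves the product weight. *)
pose phi (u : {ffun K -> T} * T) := (update u.1 k u.2, u.1 k).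
have phiK : involutive phi.
  move=> [y t]; rewrite /phi /=; congr (_, _); last by rewrite ffunE eqxx.
  by apply/ffunP => k'; rewrite !ffunE; case: eqP => // ->.
rewrite (reindex_inj (inv_inj phiK)) /=; apply: eq_bigr => -[y t] _ /=.
by rewrite weight_update ffunE eqxx gk.
Qed.
End Sampling.

Lemma sum_weights (I : finType) (P : pred I) (p : I -> rat) :
  \sum_(i | P i) p i = \sum_i p i * (P i)%:R.
Proof.
by rewrite big_mkcond; apply: eq_bigr => i _; case: (P i); rewrite ?mulr1 ?mulr0.
Qed.

(* A fractional monochromatic domination: the dual weights mu would satisfy
   1/2 \sum_th lam th * mu(S_th)^2 < eta * mu(A)^2, against Cauchy-Schwarz. *)
Lemma color_domination (T : tournament) (A : {set T}) (Om : finType) (lam : Om -> rat)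
    (c : T -> {set Om}) (q : nat) :
  (0 < q)%N -> A != set0 -> (forall th, 0 <= lam th) -> \sum_th lam th <= 1 ->
  (forall v, v \in A -> q%:R^-1 <= \sum_(th in c v) lam th) ->
  exists2 p, distr (mem A) p & forall v, v \in A ->
    (2 * q ^ 2)%N%:R^-1 <=
      \sum_y p y * \sum_th lam th * [&& darc y v, th \in c y & th \in c v]%:R.
Proof.
move=> q0 /set0Pn[a aA] lam0 lam1 cA.
pose rho (y v : T) : rat := \sum_th lam th * [&& darc y v, th \in c y & th \in c v]%:R.
set eta : rat := (2 * q ^ 2)%N%:R^-1.
have [[p dp pP]|[mu [mu0 muA] neg]] := minimax (mem A) (mem A) (fun y v => rho y v - eta).
  exists p => // v vA; have := pP v vA.
  rewrite (eq_bigr (fun y => p y * rho y v - p y * eta)) => [|y _]; last by rewrite mulrBr.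
  by rewrite big_split /= sumrN -mulr_suml; case: dp => _ _ ->; rewrite mul1r subr_ge0.
exfalso; pose M := \sum_v mu v.
have M0 : 0 < M.
  rewrite lt_neqAle sumr_ge0 // andbT eq_sym; apply/eqP => /psumr_eq0P mu_eq0.
  by have := neg a aA; rewrite big1 ?ltxx // => v _; rewrite mu_eq0 ?mul0r.
have le_tot : \sum_y mu y * \sum_v mu v * (rho y v - eta) < 0.
  have le0 y : mu y * (\sum_v mu v * (rho y v - eta)) <= 0.
    have [yA|/muA ->] := boolP (y \in A); last by rewrite mul0r.
    by rewrite mulr_ge0_le0 // ltW // neg.
  have [y y0] : exists y, 0 < mu y.
    apply/existsP; apply: contraTT M0 => /existsPn h; rewrite -leNgt.
    by apply: sumr_le0 => y _; rewrite leNgt h.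
  have yA : y \in A by apply: contraTT y0 => /muA ->; rewrite ltxx.
  rewrite (bigD1 y) //= -[ltRHS]addr0 ltr_leD //; first by rewrite pmulr_rlt0 // neg.
  by apply: sumr_le0.
pose m th := \sum_y mu y * (th \in c y)%:R.
pose X := \sum_y \sum_v mu y * mu v * rho y v.
have eqX : \sum_y mu y * \sum_v mu v * (rho y v - eta) = X - eta * M ^+ 2.
  rewrite expr2 {2}/M mulr_sumr mulr_sumr -sumrB; apply: eq_bigr => y _.
  rewrite mulr_sumr /M mulr_suml mulr_sumr -sumrB; apply: eq_bigr => v _; ring.
(* Symmetrise: of two vertices at least one dominates the other. *)
have X2 : \sum_th lam th * m th ^+ 2 <= X + X.
  have -> : \sum_th lam th * m th ^+ 2 =
      \sum_y \sum_v mu y * mu v * \sum_th lam th * ((th \in c y) && (th \in c v))%:R.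
    transitivity (\sum_th \sum_y \sum_v
        mu y * mu v * (lam th * ((th \in c y) && (th \in c v))%:R)).
      apply: eq_bigr => th _; rewrite expr2 mulrA {2}/m mulr_sumr exchange_big /=.
      apply: eq_bigr => v _; rewrite /m mulr_sumr mulr_suml; apply: eq_bigr => y _.
      rewrite -mulnb natrM; ring.
    rewrite exchange_big /=; apply: eq_bigr => y _; rewrite exchange_big /=.
    by apply: eq_bigr => v _; rewrite mulr_sumr.
  have XE : X = \sum_y \sum_v mu v * mu y * rho v y by rewrite /X exchange_big.
  rewrite {2}XE /X -big_split ler_sum //= => y _.
  rewrite -big_split ler_sum //= => v _.
  rewrite [mu v * mu y]mulrC -mulrDr ler_wpM2l ?mulr_ge0 // -big_split ler_sum //= => th _.
  rewrite -mulrDr ler_wpM2l // -natrD ler_nat.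
  have := darc_total y v.
  by case: (th \in c y) (th \in c v) (darc y v) (darc v y) => [] [] [] [].
have mM : M / q%:R <= \sum_th lam th * m th.
  have -> : \sum_th lam th * m th = \sum_y mu y * \sum_(th in c y) lam th.
    rewrite (eq_bigr (fun th => \sum_y mu y * (lam th * (th \in c y)%:R))).
      rewrite exchange_big /=; apply: eq_bigr => y _.
      by rewrite -mulr_sumr [in RHS]sum_weights.
    by move=> th _; rewrite mulr_sumr; apply: eq_bigr => y _; ring.
  rewrite mulr_suml ler_sum // => y _.
  have [yA|/muA ->] := boolP (y \in A); last by rewrite !mul0r.
  by rewrite ler_wpM2l // cA.
have [t tE] : exists t, t = \sum_th lam th * m th by eexists.
rewrite -tE in mM.
have cs : t ^+ 2 <= \sum_th lam th * m th ^+ 2.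
  have : 0 <= \sum_th lam th * (m th - t) ^+ 2.
    by apply: sumr_ge0 => th _; rewrite mulr_ge0 // sqr_ge0.
  have -> : \sum_th lam th * (m th - t) ^+ 2 =
      \sum_th lam th * m th ^+ 2 - 2 * t * t + t ^+ 2 * \sum_th lam th.
    have -> : 2 * t * t = \sum_th 2 * t * (lam th * m th) by rewrite -mulr_sumr -tE.
    rewrite mulr_sumr -sumrB -big_split; apply: eq_bigr => th _ /=; ring.
  have : t ^+ 2 * \sum_th lam th <= t ^+ 2 by rewrite ler_piMr // sqr_ge0.
  rewrite expr2; lra.
have Mq : (M / q%:R) ^+ 2 <= t ^+ 2.
  have q0' : 0 <= M / q%:R by rewrite divr_ge0 ?ler0n // ltW.
  by rewrite ler_pXn2r // nnegrE // (le_trans q0').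
have eqe : eta * M ^+ 2 = (M / q%:R) ^+ 2 / 2.
  rewrite /eta natrM natrX; field.
  by rewrite pnatr_eq0 -lt0n q0.
move: le_tot; rewrite eqX eqe; lra.
Qed.

Lemma weighted_average (I : finType) (w g : I -> rat) (b : rat) :
  (forall i, 0 <= w i) -> \sum_i w i = 1 -> b <= \sum_i w i * g i ->
  exists2 i, 0 < w i & b <= g i.
Proof.
move=> w0 w1 le_b; apply/exists_inP; apply: contraTT le_b => /exists_inPn no; rewrite -ltNge.
have lt i : 0 < w i -> g i < b by move=> /no; rewrite -ltNge.
have [i i0] : exists i, 0 < w i.
  apply/existsP; apply: contraT => /existsPn h; have : \sum_i w i <= 0.
    by apply: sumr_le0 => i _; rewrite leNgt h.
  by rewrite w1.
rewrite -[b]mul1r -w1 mulr_suml (bigD1 i) //= [ltRHS](bigD1 i) //= ltr_leD ?ltr_pM2l ?lt //.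
rewrite ler_sum // => j _; have := w0 j; rewrite le_eqVlt => /predU1P[<-|j0].
  by rewrite !mul0r.
by rewrite ler_pM2l // ltW // lt.
Qed.

(** The copies are sought among [2 * s] samples and [2 ^ s] vertices answering them. This index set
    does not depend on [T], which bounds the number of candidate maps and makes [q'] uniform. *)
Lemma rainbow_embedding (H : tournament) (q : nat) : two_colorable H -> (0 < q)%N ->
  exists K q', (0 < q')%N /\ forall (T : tournament) (A : {set T}) (Om : finType)
      (lam : Om -> rat) (c : T -> {set Om}),
    large K A -> (forall th, 0 <= lam th) -> \sum_th lam th <= 1 ->
    (forall v, v \in A -> q%:R^-1 <= \sum_(th in c v) lam th) ->
    exists g : H -> T, [/\ forall h, g h \in A, forall h h', arc h h' -> arc (g h) (g h')
      & q'%:R^-1 <= \sum_(th | [forall h, th \in c (g h)]) lam th].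
Proof.
move=> H2 q0; pose m := (2 * (2 * q ^ 2))%N.
have m0 : (0 < m)%N by rewrite /m !muln_gt0 ?expn_gt0 q0.
have [s s0 sP] := trace_embeds H2 m0.
pose Sg := {ffun 'I_s -> bool}.
pose Idx := ('I_s * bool + Sg)%type.
pose N0 := #|{: {ffun H -> Idx}}|.
exists s, (m * N0.+1)%N; split; first by rewrite muln_gt0 m0.
move=> T A Om lam c lA lam0 lam1 cA.
have A0 : A != set0 by have [a aA] := large_neq0 lA; apply/set0Pn; exists a.
have [p [p0 pA p1] pdom] := color_domination q0 A0 lam0 lam1 cA.
have [a0 a0A] := set0Pn _ A0.
(* The default [a0] is never reached for sets of at most [s] vertices, [A] being large. *)
pose vf (X : {set T}) := odflt a0 [pick a in A | [forall x in X, arc a x]].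
have vfP (X : {set T}) : (#|X| <= s)%N -> vf X \in A /\ forall x, x \in X -> arc (vf X) x.
  move=> leX; rewrite /vf; case: pickP => [a /andP[aA /forall_inP aX] //|no] /=.
  have [a aA aX] := largeP _ _ lA X leX.
  by have /negP[] := negbT (no a); rewrite aA; apply/forall_inP.
pose Y := {ffun 'I_s * bool -> T}.
pose front (y : Y) (sg : Sg) := [set y (i, sg i) | i : 'I_s].
pose v (y : Y) (sg : Sg) := vf (front y sg).
have frontP y sg : (#|front y sg| <= s)%N.
  by apply: leq_trans (leq_imset_card _ _) _; rewrite card_ord.
pose hit (y : Y) (sg : Sg) i th :=
  [&& darc (y (i, ~~ sg i)) (v y sg), th \in c (y (i, ~~ sg i)) & th \in c (v y sg)].
pose eta : rat := (2 * q ^ 2)%N%:R^-1.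
pose F (y : Y) := \sum_(sg : Sg) \sum_i \sum_th lam th * (hit y sg i th)%:R.
have [y wy Fy] : exists2 y : Y, 0 < weight p y & (2 ^ s)%N%:R * (s%:R * eta) <= F y.
  apply: weighted_average.
  - by move=> y; apply: prodr_ge0.
  - exact: weight_sum.
  have -> : \sum_y weight p y * F y =
      \sum_(sg : Sg) \sum_i \sum_(y : Y) weight p y * \sum_th lam th * (hit y sg i th)%:R.
    rewrite (eq_bigr (fun y => \sum_(sg : Sg) \sum_i
        weight p y * \sum_th lam th * (hit y sg i th)%:R)).
      rewrite exchange_big /=; apply: eq_bigr => sg _; exact: exchange_big.
    by move=> y _; rewrite mulr_sumr; apply: eq_bigr => sg _; rewrite mulr_sumr.
  have cs : (2 ^ s)%N%:R * (s%:R * eta) = \sum_(sg : Sg) \sum_(i < s) eta.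
    rewrite !sumr_const card_ord card_ffun card_bool card_ord.
    by rewrite !mulr_natl.
  rewrite cs ler_sum // => sg _; rewrite ler_sum // => i _.
  (* [v y sg] depends only on the samples [y (i, sg i)], so [y (i, ~~ sg i)] may be resampled, and
     [p] dominates [v y sg] within its colours with weight at least [eta]. *)
  pose g t (y : Y) := \sum_th lam th * [&& darc t (v y sg), th \in c t & th \in c (v y sg)]%:R.
  rewrite [leRHS](resample p1 (g := g) (k := (i, ~~ sg i))).
    rewrite -[eta]mul1r -(weight_sum ('I_s * bool)%type p1) mulr_suml ler_sum // => y _.
    rewrite ler_wpM2l ?prodr_ge0 // /eta; apply: pdom; exact: (vfP _ (frontP _ _)).1.
  move=> t y t'; rewrite /g; suff -> : v (update y (i, ~~ sg i) t') sg = v y sg by [].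
  congr vf; apply: eq_imset => j; rewrite ffunE; case: eqP => // -[-> /eqP].
  by case: (sg i).
have yA k : y k \in A.
  apply: contraTT wy => /pA pk; rewrite /weight (bigD1 k) //= pk mul0r ltxx //.
have [vA vy] : (forall sg, v y sg \in A) /\ forall sg i, arc (v y sg) (y (i, sg i)).
  split=> sg; first exact: (vfP _ (frontP _ _)).1.
  by move=> i; apply: (vfP _ (frontP _ _)).2; apply: imset_f.
pose z (k : Idx) := match k with inl k => y k | inr sg => v y sg end.
pose n th := (\sum_(sg : Sg) \sum_i (hit y sg i th : nat))%N.
pose good th := (s * 2 ^ s <= m * n th)%N.
pose ok (phi : {ffun H -> Idx}) th := [forall h, th \in c (z (phi h))] &&
  [forall h, forall h', arc h h' ==> arc (z (phi h)) (z (phi h'))].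
have good_ok th : good th -> exists phi, ok phi th.
  move=> gth; have /embedsP[g gin ga] : embeds H ((y @: setT :|: v y @: setT) :&: [set x | th \in c x]).
    apply: (sP T y (v y)) => //; suff -> : (\sum_(sg : Sg) \sum_i
      [&& darc (y (i, ~~ sg i)) (v y sg), y (i, ~~ sg i) \in [set x | th \in c x]
        & v y sg \in [set x | th \in c x]])%N = n th by [].
    by apply: eq_bigr => sg _; apply: eq_bigr => i _; rewrite !inE.
  have /fin_all_exists[k kP] h : exists k, z k = g h /\ th \in c (g h).
    have := gin h; rewrite !inE => /andP[/orP[]/imsetP[k _ ->] ->].
      by exists (inl k).
    by exists (inr k).
  exists (finfun k); apply/andP; split; apply/forallP => h.
    by rewrite ffunE; case: (kP h) => ->.
  apply/forallP => h'; apply/implyP => /ga; rewrite !ffunE.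
  by case: (kP h) (kP h') => -> _ [-> _].
have n_le th : (n th <= s * 2 ^ s)%N.
  have -> : (s * 2 ^ s = \sum_(sg : Sg) \sum_(i < s) 1)%N.
    by rewrite !sum_nat_const card_ord card_ffun card_bool card_ord muln1 mulnC.
  by apply: leq_sum => sg _; apply: leq_sum => i _; apply: leq_b1.
have S0 : 0 < (s * 2 ^ s)%N%:R :> rat by rewrite ltr0n muln_gt0 s0 expn_gt0.
have etaE : eta = m%:R^-1 + m%:R^-1.
  by rewrite /eta /m natrM [in RHS]natrM invfM; lra.
(* After division by [s * 2 ^ s], the total [F y] is at least [eta], that is [2 / m], and the bad
   colours contribute at most [1 / m] of it. *)
have lam_good : m%:R^-1 <= \sum_(th | good th) lam th.
  have FE : F y = \sum_th lam th * (n th)%:R.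
    transitivity (\sum_(sg : Sg) \sum_th \sum_i lam th * (hit y sg i th)%:R).
      by apply: eq_bigr => sg _; apply: exchange_big.
    rewrite exchange_big /=; apply: eq_bigr => th _.
    rewrite /n natr_sum mulr_sumr; apply: eq_bigr => sg _.
    by rewrite natr_sum mulr_sumr.
  have le_good : \sum_(th | good th) lam th * (n th)%:R <=
      (\sum_(th | good th) lam th) * (s * 2 ^ s)%N%:R.
    by rewrite mulr_suml ler_sum // => th _; rewrite ler_wpM2l // ler_nat.
  have le_bad : \sum_(th | ~~ good th) lam th * (n th)%:R <= m%:R^-1 * (s * 2 ^ s)%N%:R.
    apply: (@le_trans _ _ ((\sum_(th | ~~ good th) lam th) * (m%:R^-1 * (s * 2 ^ s)%N%:R))).
      rewrite mulr_suml ler_sum // => th; rewrite -ltnNge => /ltnW le_n; rewrite ler_wpM2l //.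
      by rewrite ler_pdivlMl ?ltr0n // -natrM ler_nat.
    rewrite ler_piMl ?mulr_ge0 ?invr_ge0 ?ler0n // (le_trans _ lam1) //.
    by rewrite [leRHS](bigID good) /= lerDr sumr_ge0.
  move: Fy; rewrite FE (bigID good) /= mulrA [_ * s%:R]mulrC -natrM etaE.
  move=> le_F; rewrite -(ler_pM2r S0); lra.
(* Pigeonhole over the [N0] maps from [H] to the index set. *)
have [phi lam_phi] : exists phi : {ffun H -> Idx},
    (m * N0.+1)%N%:R^-1 <= \sum_(th | ok phi th) lam th.
  apply/existsP; apply: contraTT lam_good => /existsPn no; rewrite -ltNge.
  apply: (@le_lt_trans _ _ (\sum_(phi : {ffun H -> Idx}) \sum_(th | ok phi th) lam th)).
    rewrite (eq_bigr (fun phi => \sum_th lam th * (ok phi th)%:R)) => [|phi _]; last first.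
      exact: sum_weights.
    rewrite exchange_big /= sum_weights ler_sum // => th _; rewrite -mulr_sumr ler_wpM2l //.
    case: (boolP (good th)) => [/good_ok[phi okp]|_]; last by rewrite sumr_ge0.
    by rewrite (bigD1 phi) //= okp lerDl sumr_ge0.
  apply: (@le_lt_trans _ _ (\sum_(phi : {ffun H -> Idx}) (m * N0.+1)%N%:R^-1)).
    by rewrite ler_sum // => phi _; rewrite ltW // ltNge no.
  rewrite sumr_const -[ltLHS]mulr_natl natrM invfM mulrCA gtr_pMr ?invr_gt0 ?ltr0n //.
  by rewrite ltr_pdivrMr ?ltr0n // mul1r ltr_nat ltnS.
have [th okth] : exists th, ok phi th.
  apply/existsP; apply: contraTT lam_phi => /existsPn no; rewrite -ltNge big1 => [|th].
    by rewrite invr_gt0 ltr0n muln_gt0 m0.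
  by rewrite (negPf (no th)).
exists (fun h => z (phi h)); split.
- by move=> h; case: (phi h) => [k|sg]; [apply: yA | apply: vA].
- case/andP: okth => _ /forallP hom h h' hh'.
  by have /forallP/(_ h')/implyP/(_ hh') := hom h.
- apply: (le_trans lam_phi); rewrite sum_weights [leRHS]sum_weights ler_sum // => th' _.
  by rewrite ler_wpM2l // ler_nat /ok; case: [forall h, _] => //=; case: [forall h, _].
Qed.

(** * Distributions charging copies *)

(** Average over [u] in [W] with weights [mu]: of two vertices at least one dominates the other. *)
Lemma exists_half_dominating (T : tournament) (W : {set T}) (mu : T -> rat) :
  W != set0 -> (forall v, 0 <= mu v) ->
  exists2 u, u \in W & (\sum_(v in W) mu v) / 2 <= \sum_(v in W) mu v * (darc u v)%:R.
Proof.
move=> /set0Pn[w wW] mu0; set M := \sum_(v in W) mu v.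
apply/exists_inP; apply: contraT => /exists_inPn no.
have lt u : u \in W -> \sum_(v in W) mu v * (darc u v)%:R < M / 2.
  by move=> /no; rewrite -ltNge.
have M0 : 0 < M.
  have : 0 < M / 2 by apply: le_lt_trans (lt w wW); rewrite sumr_ge0 // => v _; rewrite mulr_ge0.
  lra.
have [u uW u0] : exists2 u, u \in W & 0 < mu u.
  apply/exists_inP; apply: contraTT M0 => /exists_inPn h; rewrite -leNgt.
  by apply: sumr_le0 => u /h; rewrite leNgt.
pose X := \sum_(u in W) \sum_(v in W) mu u * mu v * (darc u v)%:R.
have ltX : X < M * (M / 2).
  rewrite mulr_suml /X (bigD1 u) //= [ltRHS](bigD1 u) //=.
  have eqm u' : \sum_(v in W) mu u' * mu v * (darc u' v)%:R =
      mu u' * \sum_(v in W) mu v * (darc u' v)%:R.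
    by rewrite mulr_sumr; apply: eq_bigr => v _; rewrite mulrA.
  rewrite eqm ltr_leD ?ltr_pM2l ?lt // ler_sum // => u' /andP[u'W _].
  by rewrite eqm ler_wpM2l // ltW // lt.
have XE : X = \sum_(u in W) \sum_(v in W) mu v * mu u * (darc v u)%:R.
  by rewrite /X exchange_big.
have : M * M <= X + X.
  rewrite {2}XE /X -big_split mulr_suml ler_sum //= => x _.
  rewrite -big_split mulr_sumr ler_sum //= => y _.
  rewrite [mu y * mu x]mulrC -mulrDr ler_peMr ?mulr_ge0 // -natrD (ler_nat _ 1).
  by have := darc_total x y; case: (darc x y); case: (darc y x).
lra.
Qed.

Section Copies.
Variables (H : tournament) (x0 : H).
Hypothesis H2 : two_colorable H.

Definition hfree (T : tournament) (S : {set T}) : bool := (S == set0) || ~~ embeds H S.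

Lemma copy_not_hfree (T : tournament) (S : {set T}) (g : H -> T) :
  (forall h, g h \in S) -> (forall h h', arc h h' -> arc (g h) (g h')) -> hfree S = false.
Proof.
move=> gS ga; apply/negbTE; rewrite negb_or negbK; apply/andP; split.
  by apply/set0Pn; exists (g x0); apply: gS.
by apply/embedsP; exists g.
Qed.

(** Take the sets [S] containing a vertex as its colours: a copy of [H] inside a positive weight of
    sets [S] would contradict that [z] lives on copy-free sets. *)
Lemma hfree_cover_not_large q : (0 < q)%N -> exists K, forall (T : tournament) (A : {set T})
    (z : {set T} -> rat), (forall S, 0 <= z S) -> (forall S, ~~ hfree S -> z S = 0) ->
  \sum_S z S <= 1 -> (forall v, v \in A -> q%:R^-1 <= \sum_S z S * (v \in S)%:R) ->
  ~~ large K A.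
Proof.
move=> /(rainbow_embedding H2)[K [q' [q'0 KP]]]; exists K => T A z z0 zF z1 zA.
apply/negP => lA; have [|g [_ ga le_g]] := KP T A _ z (fun v => [set S : {set T} | v \in S]) lA z0 z1.
  move=> v /zA; congr (_ <= _); rewrite [RHS]sum_weights.
  by apply: eq_bigr => S _; rewrite inE.
move: le_g; apply/negP; rewrite -ltNge big1 ?invr_gt0 ?ltr0n // => S /forallP gS.
apply: zF; rewrite (@copy_not_hfree _ _ g) // => h.
by have := gS h; rewrite inE.
Qed.

(* Linear programming: a pair (u, S) of a vertex and a copy-free set is played against either
   a vertex v, which wants to be dominated neither by u nor by membership in S, or a copy-free
   set S', which wants to contain u. *)
Lemma heavy_measure d : (0 < d)%N -> exists K0, forall (T : tournament) (A : {set T}),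
  large K0 A -> exists2 p, distr (mem A) p /\
      (forall U : {set T}, ~~ embeds H U -> \sum_(x in U) p x <= d%:R^-1)
    & exists2 B : {set T}, B \subset A /\ (forall K, large (K + K0) A -> large K B)
        & forall v, v \in B -> 4^-1 <= \sum_(y | darc y v) p y.
Proof.
move=> d0; have [K1 K1P] := hfree_cover_not_large d0.
have [|K2 K2P] := @hfree_cover_not_large (2 * d); first by rewrite muln_gt0.
have dR : 0 < d%:R :> rat by rewrite ltr0n.
exists (K1 + K2)%N => T A lA.
pose P (i : T * {set T}) := (i.1 \in A) && hfree i.2.
pose Q (j : T + {set T}) := match j with inl v => v \in A | inr S' => hfree S' end.
pose M (i : T * {set T}) (j : T + {set T}) : rat := match j with
  | inl v => (darc i.1 v)%:R + d%:R / 2 * (v \in i.2)%:R - 1 / 2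
  | inr S' => d%:R^-1 - (i.1 \in S')%:R end.
have [[pi [pi0 piP pi1] piM]|[mu [mu0 muQ] neg]] := minimax P Q M.
  pose p u := \sum_S pi (u, S); pose z S := \sum_u pi (u, S).
  have pE (f : T -> rat) : \sum_i pi i * f i.1 = \sum_u p u * f u.
    rewrite (eq_bigr (fun i => pi (i.1, i.2) * f i.1)) => [|[? ?] _ //].
    rewrite -(pair_bigA _ (fun u S => pi (u, S) * f u)) /=.
    by apply: eq_bigr => u _; rewrite /p mulr_suml.
  have zE (f : {set T} -> rat) : \sum_i pi i * f i.2 = \sum_S z S * f S.
    rewrite (eq_bigr (fun i => pi (i.1, i.2) * f i.2)) => [|[? ?] _ //].
    rewrite -(pair_bigA _ (fun u S => pi (u, S) * f S)) /= exchange_big /=.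
    by apply: eq_bigr => S _; rewrite /z mulr_suml.
  have p1 : \sum_u p u = 1.
    have := pE (fun=> 1); rewrite (eq_bigr pi) => [|i _]; last by rewrite mulr1.
    by rewrite pi1 => ->; apply: eq_bigr => u _; rewrite mulr1.
  have z1 : \sum_S z S = 1.
    have := zE (fun=> 1); rewrite (eq_bigr pi) => [|i _]; last by rewrite mulr1.
    by rewrite pi1 => ->; apply: eq_bigr => u _; rewrite mulr1.
  have z0 S : 0 <= z S by apply: sumr_ge0.
  have zF S : ~~ hfree S -> z S = 0.
    by move=> nS; apply: big1 => u _; apply: piP; rewrite negb_and nS orbT.
  have pdom v : v \in A ->
      1 / 2 <= \sum_(y | darc y v) p y + d%:R / 2 * \sum_S z S * (v \in S)%:R.
    move=> vA; have := piM (inl v) vA; rewrite /M.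
    rewrite (eq_bigr (fun i => pi i * (darc i.1 v)%:R + (d%:R / 2 * (pi i * (v \in i.2)%:R)
        - pi i * (1 / 2)))) => [|i _]; last by ring.
    rewrite big_split sumrB /= -mulr_sumr -mulr_suml pi1.
    rewrite (pE (fun u => (darc u v)%:R)) (zE (fun S => (v \in S)%:R)).
    rewrite [\sum_(y | darc y v) p y]sum_weights; lra.
  exists p.
    split; first split=> //.
    - by move=> u; apply: sumr_ge0.
    - by move=> u nu; apply: big1 => S _; apply: piP; rewrite negb_and nu.
    move=> U nU; have hU : Q (inr U) by rewrite /= /hfree nU orbT.
    have := piM (inr U) hU; rewrite /M.
    rewrite (eq_bigr (fun i => pi i * d%:R^-1 - pi i * (i.1 \in U)%:R)) => [|i _]; last by ring.
    by rewrite sumrB -mulr_suml pi1 mul1r (pE (fun u => (u \in U)%:R)) -sum_weights subr_ge0.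
  (* Vertices covered by copy-free sets with weight at least [1 / (2 * d)] do not form a large set;
     elsewhere covering accounts for at most 1/4 of the payoff 1/2. *)
  pose Bad := [set v in A | (2 * d)%N%:R^-1 <= \sum_S z S * (v \in S)%:R].
  have nBad : ~~ large K2 Bad.
    by apply: (K2P _ _ z) => // [|v]; rewrite ?z1 // inE => /andP[].
  exists (A :\: Bad); first split; first exact: subsetDl.
    move=> K lK; apply: (large_split (A := A) _ _ nBad).
      by apply/subsetP => v vA; rewrite !inE vA; case: (_ <= _).
    by apply: largeW lK; lia.
  move=> v; rewrite !inE => /andP[+ vA]; rewrite vA /= -ltNge => lt_z.
  have := pdom v vA.
  have : d%:R / 2 * \sum_S z S * (v \in S)%:R <= d%:R / 2 * (2 * d)%N%:R^-1.
    by rewrite ler_wpM2l ?divr_ge0 ?ler0n // ltW.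
  have -> : d%:R / 2 * (2 * d)%N%:R^-1 = 4^-1 :> rat.
    by rewrite natrM; field; rewrite gt_eqF.
  lra.
exfalso.
pose m v := mu (inl v); pose r S := mu (inr S).
pose R := \sum_S r S; pose ru u := \sum_S r S * (u \in S)%:R.
have m0 v : 0 <= m v by apply: mu0.
have r0 S : 0 <= r S by apply: mu0.
have mA v : v \notin A -> m v = 0 by move=> nv; apply: muQ.
have rF S : ~~ hfree S -> r S = 0 by move=> nS; apply: muQ.
have R0 : 0 <= R by apply: sumr_ge0.
have ru_le u : ru u <= R.
  by apply: ler_sum => S _; rewrite ler_piMr //; case: (_ \in _); rewrite ?lerr ?ler01.
have key u S : u \in A -> hfree S ->
    \sum_v m v * (darc u v)%:R + d%:R / 2 * (\sum_(v in S) m v) - (\sum_v m v) / 2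
      + R / d%:R - ru u < 0.
  move=> uA hS; have := neg (u, S); rewrite /P /= uA hS => /(_ isT).
  rewrite big_sumType /= /M /=; congr (_ < 0).
  rewrite (eq_bigr (fun v => m v * (darc u v)%:R + (d%:R / 2 * (m v * (v \in S)%:R)
      - m v * (1 / 2)))) => [|v _]; last by rewrite /m; ring.
  rewrite (eq_bigr (fun S => r S * d%:R^-1 - r S * (u \in S)%:R)) => [|S' _]; last first.
    by rewrite /r; ring.
  rewrite big_split /= !sumrB -mulr_sumr -!mulr_suml [\sum_(v in S) m v]sum_weights /R /ru.
  by ring.
(* [U] collects the vertices that the dual sets hit with more than the share [1 / d]. It is not all
   of [A], since [A] would then be covered by copy-free sets and not be large. *)
pose U := [set u in A | R / d%:R < ru u].
have W0 : A :\: U != set0.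
  apply/set0Pn; apply/existsP; apply: contraT => /existsPn no.
  have AU u : u \in A -> R / d%:R < ru u.
    by move=> uA; have := no u; rewrite !inE uA /= andbT negbK.
  have [a aA] := large_neq0 lA.
  have Rp : 0 < R.
    rewrite lt_neqAle R0 andbT; have := AU a aA; apply: contraTneq => R_0.
    by rewrite -R_0 mul0r -leNgt; apply: le_trans (ru_le a) _; rewrite -R_0.
  have : ~~ large K1 A.
    apply: (K1P _ _ (fun S => r S / R)).
    - by move=> S; rewrite divr_ge0.
    - by move=> S /rF ->; rewrite mul0r.
    - by rewrite -mulr_suml divff // gt_eqF.
    move=> v /AU /ltW; rewrite (eq_bigr (fun S => (r S * (v \in S)%:R) / R)) => [|S _]; last by ring.
    rewrite -mulr_suml ler_pdivlMr // mulrC //.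
  by rewrite (largeW _ lA) // leq_addr.
have [u uW le_u] := exists_half_dominating W0 m0.
(* Averaging with the weights [r] gives a copy-free [S] with at least [1 / d] of the mass of [U];
   against the pair [(u, S)] the dual solution fails. *)
have [S hS le_S] : exists2 S, hfree S & \sum_(v in U) m v <= d%:R * \sum_(v in S) m v.
  apply/exists_inP; apply: contraT => /exists_inPn no.
  have lt S : hfree S -> d%:R * (\sum_(v in S) m v) < \sum_(v in U) m v.
    by move=> /no; rewrite -ltNge.
  have mU0 : 0 < \sum_(v in U) m v.
    by have := lt set0; rewrite /hfree eqxx big_set0 mulr0; apply.
  have [v vU] : exists v, v \in U.
    by apply/set0Pn; apply: contraTneq mU0 => ->; rewrite big_set0 ltxx.
  have Rp : 0 < R.
    move: vU; rewrite inE => /andP[_ ltv]; apply: lt_le_trans (ru_le v).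
    by apply: le_lt_trans ltv; rewrite divr_ge0 // ler0n.
  have [S1 S1p] : exists S, 0 < r S.
    apply/existsP; apply: contraTT Rp => /existsPn h; rewrite -leNgt.
    by apply: sumr_le0 => S' _; rewrite leNgt h.
  have h1 : (\sum_(v in U) m v) * (R / d%:R) <= \sum_S r S * \sum_(v in S) m v.
    have -> : \sum_S r S * \sum_(v in S) m v = \sum_v m v * ru v.
      rewrite (eq_bigr (fun S => \sum_v m v * (r S * (v \in S)%:R))) => [|S' _].
        by rewrite exchange_big /=; apply: eq_bigr => v' _; rewrite -mulr_sumr.
      by rewrite sum_weights mulr_sumr; apply: eq_bigr => v' _; ring.
    rewrite mulr_suml [leRHS](bigID (mem U)) /= -[leLHS]addr0 lerD //.
      by rewrite ler_sum // => v'; rewrite inE => /andP[_ /ltW lev]; rewrite ler_wpM2l.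
    by rewrite sumr_ge0 // => v' _; rewrite mulr_ge0 // sumr_ge0 // => S' _; rewrite mulr_ge0.
  have h2 : \sum_S r S * (\sum_(v in S) m v) < \sum_S r S * ((\sum_(v in U) m v) / d%:R).
    have hS' S' : 0 < r S' -> r S' * (\sum_(v in S') m v) < r S' * ((\sum_(v in U) m v) / d%:R).
      move=> rS'; rewrite ltr_pM2l // ltr_pdivlMr // mulrC lt //.
      by apply: contraTT rS' => /rF ->; rewrite ltxx.
    rewrite (bigD1 S1) //= [ltRHS](bigD1 S1) //= ltr_leD ?hS' // ler_sum // => S' _.
    have := r0 S'; rewrite le_eqVlt => /predU1P[<-|/hS' /ltW //]; by rewrite !mul0r.
  have : \sum_S r S * ((\sum_(v in U) m v) / d%:R) = (\sum_(v in U) m v) * (R / d%:R).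
    by rewrite -mulr_suml /R; ring.
  move: h1 h2; lra.
have uA : u \in A by move: uW; rewrite inE => /andP[].
have := key u S uA hS.
have ru_u : ru u <= R / d%:R by move: uW; rewrite !inE uA /= andbT -leNgt.
have tot : \sum_v m v = \sum_(v in A :\: U) m v + \sum_(v in U) m v.
  rewrite (bigID (mem A)) /= [X in _ + X]big1 ?addr0; last by move=> v /mA.
  rewrite (bigID (mem U)) /= addrC; congr (_ + _); apply: eq_bigl => v; rewrite !inE.
    by case: (v \in A); rewrite /= ?andbT ?andbF.
  by case: (v \in A); rewrite /= ?andbT ?andbF.
have le_W : \sum_(v in A :\: U) m v * (darc u v)%:R <= \sum_v m v * (darc u v)%:R.
  rewrite [leRHS](bigID (mem (A :\: U))) /= lerDl sumr_ge0 // => v _.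
  by rewrite mulr_ge0.
move: le_u le_S; lra.
Qed.

End Copies.

(** * Cyclic triples *)

(** A copy of [Delta H H H], given by three arc-preserving maps. *)
Definition cyclic_triple (H T : tournament) : Prop :=
  exists g1 g2 g3 : H -> T,
    [/\ forall x y, arc x y -> [/\ arc (g1 x) (g1 y), arc (g2 x) (g2 y) & arc (g3 x) (g3 y)],
        forall x y, arc (g1 x) (g2 y), forall x y, arc (g2 x) (g3 y)
      & forall x y, arc (g3 x) (g1 y)].

Lemma ler_sum_subset (I : finType) (P Q : pred I) (p : I -> rat) :
  (forall i, 0 <= p i) -> (forall i, P i -> Q i) -> \sum_(i | P i) p i <= \sum_(i | Q i) p i.
Proof.
move=> p0 PQ; rewrite sum_weights [leRHS]sum_weights ler_sum // => i _; rewrite ler_wpM2l //.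
by rewrite ler_nat; have := PQ i; case: (P i) => //; case: (Q i) => // /(_ isT).
Qed.

Section Triple.
Variables (H : tournament) (x0 : H).
Hypothesis H2 : two_colorable H.

(* While B is large and dominated by p0 inside Q, either a large part of B sends
   arcs to almost nothing in Q, or a copy Y in B dominates a set Q1 of positive
   measure; in the latter case either Q1 still dominates a large part of B, which contains a
   copy that closes the triangle, or Q1 may be discarded. *)
Lemma cyclic_triple_or_sparse d e : (0 < d)%N -> (0 < e)%N -> exists K1,
  forall (T : tournament) (A : {set T}) K, large (K + K1) A ->
  cyclic_triple H T \/
  exists2 p, distr (mem A) p /\
      (forall U : {set T}, ~~ embeds H U -> \sum_(x in U) p x <= d%:R^-1)
    & exists2 B : {set T}, B \subset A /\ large K B
        & forall v, v \in B -> \sum_(y | darc v y) p y <= e%:R^-1.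
Proof.
move=> d0 e0.
have [|Kr [m [m0 RP]]] := @rainbow_embedding H (8 * e) H2; first by rewrite muln_gt0.
have [|Ks [m2 [m20 SP]]] := @rainbow_embedding H (8 * m) H2; first by rewrite muln_gt0.
(* The bound lies below [1 / m2], so a set of that mass contains a copy, and below [1 / (8 * d)], so
   that restricting to a set of mass at least 1/8 keeps the bound [1 / d]. *)
have [|K0 heavyP] := @heavy_measure H x0 H2 (8 * d * m2.+1); first by rewrite !muln_gt0 d0.
have [Kc leKr leKs] : exists2 Kc, (Kr <= Kc)%N & (Ks + #|H| <= Kc)%N.
  by exists (Kr + (Ks + #|H|))%N; rewrite ?leq_addr ?leq_addl.
exists (K0 + m * Kc)%N => T A K lA.
have [|p0 [[p_ge0 pA p1] p_heavy] [B0 [sB0A lB0] B0dom]] := heavyP T A.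
  by apply: largeW lA; lia.
have mR : 0 < m%:R :> rat by rewrite ltr0n.
have m2R : 0 < m2%:R :> rat by rewrite ltr0n.
have dR : 0 < d%:R :> rat by rewrite ltr0n.
have eR : 0 < e%:R :> rat by rewrite ltr0n.
have e1R : 1 <= e%:R :> rat by rewrite ler1n.
have heavy_lt (U : {set T}) : m2%:R^-1 <= \sum_(x in U) p0 x -> embeds H U.
  apply: contraTT => /p_heavy le_U; rewrite -ltNge; apply: le_lt_trans le_U _.
  by rewrite ltf_pV2 ?posrE ?ltr0n ?muln_gt0 ?d0 // ltr_nat leq_pmull // muln_gt0 d0.
have p_le1 : \sum_y p0 y <= 1 by rewrite p1.
(* Each discarded [Q1] costs [Q] at least [1 / m] of mass, and the remaining vertices of [B] at most
   [1 / (8 * m)] of domination. The start has 1/4 = 1/8 + 1/8; after [m] rounds [Q] would have mass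
   0 and still dominate with weight 1/8. *)
suff loop n (Q B : {set T}) : B \subset A -> large (K + n * Kc) B ->
    \sum_(y in Q) p0 y <= n%:R / m%:R ->
    (forall v, v \in B -> 8^-1 + n%:R / (8 * m%:R) <= \sum_(y in Q | darc y v) p0 y) ->
  cyclic_triple H T \/
  exists2 p, distr (mem A) p /\
      (forall U : {set T}, ~~ embeds H U -> \sum_(x in U) p x <= d%:R^-1)
    & exists2 B : {set T}, B \subset A /\ large K B
        & forall v, v \in B -> \sum_(y | darc v y) p y <= e%:R^-1.
  apply: (loop m setT B0 sB0A).
  - by apply: lB0; apply: largeW lA; lia.
  - by rewrite divff ?gt_eqF // -p1; apply: ler_sum_subset.
  move=> v /B0dom le4; apply: (@le_trans _ _ 4^-1).
    by rewrite (_ : m%:R / _ = 8^-1); [lra | field; rewrite gt_eqF].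
  by apply: le_trans le4 _; apply: ler_sum_subset => // y; rewrite in_setT.
elim: n Q B => [|n IH] Q B sBA lB leQ domB.
  have [b bB] := large_neq0 lB; exfalso.
  have := domB b bB; have : \sum_(y in Q | darc y b) p0 y <= \sum_(y in Q) p0 y.
    by apply: ler_sum_subset => // y /andP[].
  move: leQ; rewrite !mul0r; lra.
set P := \sum_(y in Q) p0 y in leQ *.
have P8 : 8^-1 <= P.
  have [b bB] := large_neq0 lB; apply: le_trans (_ : \sum_(y in Q | darc y b) p0 y <= _).
    by apply: le_trans (domB b bB); rewrite lerDl divr_ge0 ?ler0n // mulr_ge0 ?ler0n.
  by apply: ler_sum_subset => // y /andP[].
have P0 : 0 < P by lra.
pose B' := [set v in B | \sum_(y in Q | darc v y) p0 y <= P / e%:R].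
have sB'B : B' \subset B by apply/subsetP => v; rewrite inE => /andP[].
have [lB'|nB'] := boolP (large K B').
  right; exists (fun y => (p0 y * (y \in Q)%:R) / P).
    split; first split=> [y|y ny|].
    - by rewrite divr_ge0 ?mulr_ge0 // ltW.
    - by rewrite pA // !mul0r.
    - by rewrite -mulr_suml -sum_weights divff // gt_eqF.
    move=> U nU; rewrite -mulr_suml ler_pdivrMr //.
    apply: le_trans (_ : \sum_(x in U) p0 x <= _).
      by rewrite ler_sum // => y _; rewrite ler_piMr //; case: (_ \in _); rewrite ?lerr ?ler01.
    apply: le_trans (p_heavy U nU) _; apply: le_trans (_ : d%:R^-1 * 8^-1 <= _).
      by rewrite -invfM -natrM lef_pV2 ?posrE ?ltr0n ?muln_gt0 ?d0 // ler_nat mulnC leq_pmulr.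
    by rewrite ler_wpM2l // invr_ge0 ler0n.
  exists B'; first by split=> //; apply: subset_trans sBA.
  move=> v; rewrite inE => /andP[_ lev]; rewrite -mulr_suml ler_pdivrMr // [leRHS]mulrC.
  apply: le_trans lev; rewrite [leLHS]sum_weights [leRHS]sum_weights ler_sum // => y _.
  by rewrite -mulrA -natrM mulnb.
have lZ : large Kr (B :\: B').
  apply: (large_split (A := B) (B := B') (K := K)) => //.
    by apply/subsetP => v vB; rewrite in_setU in_setD vB; case: (v \in B').
  by apply: largeW lB; rewrite leq_add2l mulSn (leq_trans leKr) ?leq_addr.
have [|gY [gYZ gYa leY]] := RP T _ T p0 (fun v => [set y in Q | darc v y]) lZ p_ge0 p_le1.
  move=> v; rewrite in_setD inE => /andP[+ vB]; rewrite vB /= -ltNge => /ltW ltv.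
  rewrite (eq_bigl (fun y => (y \in Q) && darc v y)) => [|y]; last by rewrite inE.
  apply: le_trans ltv; rewrite natrM invfM ler_wpM2r // invr_ge0 ler0n //.
have gYB h : gY h \in B by have := gYZ h; rewrite in_setD => /andP[].
pose Q1 := [set y | [forall h, y \in [set y in Q | darc (gY h) y]]].
have Q1P y : y \in Q1 -> y \in Q /\ forall h, darc (gY h) y.
  rewrite inE => /forallP yh; split=> [|h]; first by have := yh x0; rewrite inE => /andP[].
  by have := yh h; rewrite inE => /andP[].
have le1 : m%:R^-1 <= \sum_(y in Q1) p0 y.
  by apply: le_trans leY _; apply: ler_sum_subset => // y; rewrite inE.
pose B1 := [set v in B | (8 * m)%N%:R^-1 <= \sum_(y in Q1 | darc y v) p0 y].
have [lB1|nB1] := boolP (large (Ks + #|H|) B1).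
  (* The copy [gA] beats [gY], and the heavy set [X] fits between them: it is dominated by [gY] and
     dominates [gA]. *)
  left; pose A1 := [set v in B1 | [forall x in gY @: [set: H], arc v x]].
  have lA1 : large Ks A1.
    apply: large_beating; apply: largeW lB1; rewrite leq_add2l.
    by apply: leq_trans (leq_imset_card _ _) _; rewrite cardsT.
  have [|gA [gAA gAa leA]] := SP T _ T p0 (fun v => [set y in Q1 | darc y v]) lA1 p_ge0 p_le1.
    move=> v; rewrite inE => /andP[+ _]; rewrite inE => /andP[_ lev].
    by apply: le_trans lev _; apply: ler_sum_subset => // y; rewrite inE.
  have gAY h h' : arc (gA h) (gY h').
    have := gAA h; rewrite inE => /andP[_ /forall_inP]; apply; exact: imset_f.
  pose X := [set y | [forall h, y \in [set y in Q1 | darc y (gA h)]]].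
  have /embedsP[gX gXX gXa] : embeds H X.
    by apply: heavy_lt; apply: le_trans leA _; apply: ler_sum_subset => // y; rewrite inE.
  have XP h : (forall h', darc (gY h') (gX h)) /\ forall h', darc (gX h) (gA h').
    have := gXX h; rewrite inE => /forallP yh; split=> [|h'].
      by have := yh x0; rewrite inE => /andP[/Q1P[]].
    by have := yh h'; rewrite inE => /andP[].
  exists gY, gX, gA; split=> // [x y xy|x y|x y].
  - by split; [apply: gYa | apply: gXa | apply: gAa].
  (* A vertex of [gX] cannot equal one of [gY], as the former dominates [gA] while [gA] beats the
     latter. *)
  - rewrite -darc_arc; first exact: (XP y).1.
    by apply: contraTneq ((XP y).2 x0) => <-; rewrite darcN.
  - rewrite -darc_arc; first exact: (XP x).2.
    by apply: contraTneq ((XP x).1 x0) => ->; rewrite darcN.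
apply: (IH (Q :\: Q1) (B :\: B1)).
- exact: subset_trans (subsetDl _ _) sBA.
- apply: (large_split (A := B) (B := B1) (K := (Ks + #|H|)%N)) => //.
    by apply/subsetP => v vB; rewrite in_setU in_setD vB; case: (v \in B1).
  by apply: largeW lB; rewrite mulSn [leqRHS]addnCA leq_add2r.
- have : P = \sum_(y in Q1) p0 y + \sum_(y in Q :\: Q1) p0 y.
    rewrite /P (bigID (mem Q1)) /=; congr (_ + _); apply: eq_bigl => y.
      by case: (boolP (y \in Q1)) => [/Q1P[-> _]|]; rewrite ?andbF.
    by rewrite in_setD andbC.
  move: leQ le1; rewrite -natr1 mulrDl mul1r; lra.
move=> v; rewrite in_setD inE => /andP[+ vB]; rewrite vB /= -ltNge => ltv.
have : \sum_(y in Q | darc y v) p0 y =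
    \sum_(y in Q1 | darc y v) p0 y + \sum_(y in Q :\: Q1 | darc y v) p0 y.
  rewrite (bigID (mem Q1)) /=; congr (_ + _); apply: eq_bigl => y.
    by case: (boolP (y \in Q1)) => [/Q1P[-> _]|]; rewrite ?andbF ?andbT.
  by rewrite in_setD; case: (y \in Q1); case: (y \in Q); rewrite /= ?andbF ?andbT.
have := domB v vB; rewrite -[n.+1%:R]natr1 mulrDl mul1r; move: ltv; rewrite natrM; lra.
Qed.

(** Unless a triple appears at once, two successive sparse distributions arise: nearly all weight of
    arcs goes from [p1] to [B1], which carries [p2], and from [p2] to [B2]. The copy [g1] comes from
    a set heavy for [p1], [g3] from the vertices of [B2] beating [g1], and [g2] from a set heavy for
    [p2]. *)
Lemma large_cyclic_triple : exists K, forall T : tournament, large K [set: T] -> cyclic_triple H T.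
Proof.
have h0 : (0 < #|H|)%N by apply/card_gt0P; exists x0.
set h := #|H| in h0.
have [||K1 sparseP] := @cyclic_triple_or_sparse 4 (16 * h); rewrite ?muln_gt0 //.
have [|Kt [qt [_ RP]]] := @rainbow_embedding H 1 H2; first by [].
exists (Kt + h + K1 + K1)%N => T lT.
have [//|[p1 [[p1_ge0 _ p1_1] p1_heavy] [B1 [_ lB1] B1sp]]] := sparseP T setT _ lT.
have [//|[p2 [[p2_ge0 p2B p2_1] p2_heavy] [B2 [sB2 lB2] B2sp]]] := sparseP T B1 _ lB1.
have hR : 0 < h%:R :> rat by rewrite ltr0n.
(* By Markov's inequality at most a quarter of [p1] lies outside [U]. *)
pose U := [set y | \sum_(x | darc x y) p2 x < (4 * h%:R)^-1].
have /embedsP[g1 g1U g1a] : embeds H U.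
  apply: contraT => /p1_heavy leU; exfalso.
  have tot : \sum_y p1 y * \sum_(x | darc x y) p2 x <= (16 * h)%N%:R^-1.
    have -> : \sum_y p1 y * \sum_(x | darc x y) p2 x = \sum_x p2 x * \sum_(y | darc x y) p1 y.
      rewrite (eq_bigr (fun y => \sum_x p1 y * p2 x * (darc x y)%:R)) => [|y _].
        rewrite exchange_big /=; apply: eq_bigr => x _; rewrite [in RHS]sum_weights mulr_sumr.
        by apply: eq_bigr => y _; ring.
      by rewrite [in LHS]sum_weights mulr_sumr; apply: eq_bigr => x _; ring.
    apply: (@le_trans _ _ ((\sum_x p2 x) * (16 * h)%N%:R^-1)); last by rewrite p2_1 mul1r.
    rewrite mulr_suml ler_sum // => x _.
    have [xB|/p2B ->] := boolP (x \in B1); last by rewrite !mul0r.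
    by rewrite ler_wpM2l // B1sp.
  have : (\sum_(y in ~: U) p1 y) * (4 * h%:R)^-1 <= \sum_y p1 y * \sum_(x | darc x y) p2 x.
    rewrite mulr_suml [leRHS](bigID (mem (~: U))) /= -[leLHS]addr0 lerD //.
      by rewrite ler_sum // => y; rewrite !inE -leNgt => ley; rewrite ler_wpM2l.
    by rewrite sumr_ge0 // => y _; rewrite mulr_ge0 // sumr_ge0.
  have : 1 = \sum_(y in U) p1 y + \sum_(y in ~: U) p1 y.
    rewrite -p1_1 (bigID (mem U)) /=; congr (_ + _); apply: eq_bigl => y.
    by rewrite in_setC.
  have -> : (4 * h%:R)^-1 = 4 * (16 * h)%N%:R^-1 :> rat.
    by rewrite natrM; field; rewrite gt_eqF.
  have : 0 < (16 * h)%N%:R^-1 :> rat by rewrite invr_gt0 ltr0n muln_gt0.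
  move: (_^-1) tot leU => k; set a := \sum_(y in U) _; set b := \sum_(y in ~: U) _.
  move=> le1 le2 k0 eq1 le3; nra.
pose A1 := [set v in B2 | [forall x in g1 @: [set: H], arc v x]].
have lA1 : large Kt A1.
  apply: large_beating; apply: largeW lB2; rewrite leq_add2l.
  by apply: leq_trans (leq_imset_card _ _) _; rewrite cardsT.
(* With a single colour, monochromatic copies are plain copies in a large set. *)
have [||v _|g3 [g3A g3a _]] := RP T A1 unit (fun=> 1) (fun=> setT) lA1 => //.
- by rewrite big_const card_unit /= addr0.
- by rewrite big_const cardsT card_unit /= addr0 invr1.
have g31 x y : arc (g3 x) (g1 y).
  by have := g3A x; rewrite inE => /andP[_ /forall_inP]; apply; apply: imset_f.
have g3B x : g3 x \in B2 by have := g3A x; rewrite inE => /andP[].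
pose X := [set x | [forall y, arc (g1 y) x && arc x (g3 y)]].
have /embedsP[g2 g2X g2a] : embeds H X.
  (* The vertices of [g1] and [g3] exclude masses at most 1/4 and 1/16 from [X], which leaves more
     than the 1/4 allowed to sets without a copy. *)
  apply: contraT => /p2_heavy leX; exfalso.
  have : 1 <= \sum_(x in X) p2 x + \sum_y (\sum_(x | darc x (g1 y)) p2 x)
      + \sum_y (\sum_(x | darc (g3 y) x) p2 x).
    have sw (r : H -> pred T) :
        \sum_y \sum_(x | r y x) p2 x = \sum_x p2 x * \sum_y (r y x)%:R.
      rewrite (eq_bigr (fun y => \sum_x p2 x * (r y x)%:R)) => [|y _]; last exact: sum_weights.
      by rewrite exchange_big /=; apply: eq_bigr => x _; rewrite -mulr_sumr.
    rewrite (sw (fun y x => darc x (g1 y))) (sw (fun y x => darc (g3 y) x)) sum_weights.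
    rewrite -[leLHS]p2_1 -!big_split ler_sum //= => x _; rewrite -!mulrDr ler_peMr //.
    have ge0 (r : H -> bool) : 0 <= \sum_y (r y)%:R :> rat by apply: sumr_ge0.
    have ge1 (r : H -> bool) y : r y -> 1 <= \sum_y (r y)%:R :> rat.
      by move=> ry; rewrite (bigD1 y) //= ry lerDl sumr_ge0.
    have := ge0 (fun y => darc x (g1 y)); have := ge0 (fun y => darc (g3 y) x).
    have [_|] := boolP (x \in X); first by rewrite /= mulr1n; lra.
    rewrite inE => /forallPn[y]; rewrite negb_and -!darcN !negbK => /orP[xy|xy].
      by have := ge1 (fun y => darc x (g1 y)) y xy; rewrite /= ?mulr0n; lra.
    by have := ge1 (fun y => darc (g3 y) x) y xy; rewrite /= ?mulr0n; lra.
  have : \sum_y (\sum_(x | darc x (g1 y)) p2 x) <= 4^-1.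
    apply: le_trans (_ : \sum_(y : H) (4 * h%:R)^-1 <= _).
      by rewrite ler_sum // => y _; have := g1U y; rewrite inE => /ltW.
    rewrite sumr_const -mulr_natl -/h; rewrite le_eqVlt; apply/orP; left; apply/eqP; field.
    by rewrite gt_eqF.
  have : \sum_y (\sum_(x | darc (g3 y) x) p2 x) <= 16^-1.
    apply: le_trans (_ : \sum_(y : H) (16 * h)%N%:R^-1 <= _).
      by rewrite ler_sum // => y _; apply: B2sp.
    rewrite sumr_const -mulr_natl -/h natrM; rewrite le_eqVlt; apply/orP; left; apply/eqP; field.
    by rewrite gt_eqF.
  lra.
exists g1, g2, g3; split=> // [x y xy|x y|x y].
- by split; [apply: g1a | apply: g2a | apply: g3a].
- by have := g2X y; rewrite inE => /forallP/(_ x)/andP[].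
- by have := g2X x; rewrite inE => /forallP/(_ y)/andP[].
Qed.

End Triple.

Local Close Scope ring_scope.

(** * Reduction of three heroes to one 2-colourable tournament *)

Section Join.
Variables H1 H2 : tournament.

Definition join_arc : rel (H1 + H2)%type := fun x y =>
  match x, y with
  | inl a, inl b => arc a b
  | inr a, inr b => arc a b
  | inl _, inr _ => true
  | inr _, inl _ => false
  end.

Lemma join_arc_irr : irreflexive join_arc.
Proof. by case=> x; apply: arc_irr. Qed.

Lemma join_arc_xor x y : x != y -> join_arc x y (+) join_arc y x.
Proof. by case: x y => [x|x] [y|y] // xy; apply: arc_xor. Qed.

Definition join : tournament := Tournament join_arc_irr join_arc_xor.

(** All arcs between the parts go one way, so both can use the same two colours. *)
Lemma two_colorable_join : two_colorable H1 -> two_colorable H2 -> two_colorable join.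
Proof.
case=> f1 f1P [f2 f2P].
exists (fun x => match x with inl a => f1 a | inr a => f2 a end).
by case=> x [] y [] z //=; [apply: f1P | apply: f2P].
Qed.
End Join.

Lemma large_of_dom (T : tournament) K : K < dom T -> large K [set: T].
Proof.
rewrite /dom; case: arg_minnP => [|D domD minD ltK]; first exact: dominating_setT.
apply/largeP => X leX; have : ~~ dominating X.
  by apply/negP => /minD; rewrite leqNgt (leq_ltn_trans leX ltK).
rewrite negb_forall_in => /exists_inP[y]; rewrite inE => yX /exists_inPn no.
exists y => // x xX; rewrite -darcN negb_or no // andbT.
by apply: contraNneq yX => <-.
Qed.

Lemma cyclic_triple_not_free (H H1 H2 H3 : tournament) (i1 : H1 -> H) (i2 : H2 -> H)
    (i3 : H3 -> H) (T : tournament) :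
  (forall x y, arc x y -> arc (i1 x) (i1 y)) -> (forall x y, arc x y -> arc (i2 x) (i2 y)) ->
  (forall x y, arc x y -> arc (i3 x) (i3 y)) -> cyclic_triple H T -> ~ free (Delta H1 H2 H3) T.
Proof.
move=> a1 a2 a3 [g1 [g2 [g3 [ga g12 g23 g31]]]].
apply: (@hom_not_free _ _ (fun x : Delta H1 H2 H3 =>
  match x with inl (inl a) => g1 (i1 a) | inl (inr a) => g2 (i2 a) | inr a => g3 (i3 a) end)).
case=> [[x|x]|x] [[y|y]|y] //= xy.
- by case: (ga _ _ (a1 _ _ xy)).
- by case: (ga _ _ (a2 _ _ xy)).
- by case: (ga _ _ (a3 _ _ xy)).
Qed.

Unset Implicit Arguments.

Theorem mainTheorem4 (H1 H2 H3 : tournament) :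
  hero H1 -> hero H2 -> hero H3 -> rebel (Delta H1 H2 H3).
Proof.
move=> /hero_two_colorable c1 /hero_two_colorable c2 /hero_two_colorable c3.
pose H := join (join H1 H2) H3.
have cH : two_colorable H by do 2?apply: two_colorable_join.
(* If all three heroes are null, [Delta] is null and occurs in every tournament. *)
have [x0 _|H0] := pickP (fun _ : H => true); last first.
  exists 1 => // T freeT; exfalso.
  have vac (x : Delta H1 H2 H3) : False.
    by case: x => [[a|a]|a];
       [have := H0 (inl (inl a)) | have := H0 (inl (inr a)) | have := H0 (inr a)].
  by apply: (hom_not_free (g := fun x => match vac x with end)) freeT => x; case: (vac x).
have [K KP] := large_cyclic_triple x0 cH.
exists K.+1 => // T freeT; rewrite ltnNge; apply/negP => /large_of_dom/KP trip.
exact: (@cyclic_triple_not_free H H1 H2 H3 (fun a => inl (inl a)) (fun a => inl (inr a)) inr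
  T) trip freeT.
Qed.
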